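(* For each $k\in\{2,\ldots,N\}$ let $P_k=\{Y^{(k)}_l\}_{l=1}^{L_k}$ be an ordered Borel partition of $X_k$. If the optimal plans $\lambda$ of (MKP) are $(c,P_N)$-extreme (with $c$ regarded as a function on $Z_N\times X_N$ and $\lambda\in\Pi(\lambda_{N-1},\mu_N)$) and are such that $\lambda_j=\pi_{\mathcal{P}_j}\#\lambda$ is $(c_j,P_j)$-extreme (with $c_j$ regarded as a function on $Z_j\times X_j$ and $\lambda_j\in\Pi(\lambda_{j-1},\mu_j)$) for every $j\in\{2,\ldots,N-1\}$, then (MKP) admits a unique optimal plan.
   Context: Let $N\ge 3$, $\mathcal{N}=\{1,\ldots,N\}$, $\mu_k$ Borel probability measures on complete separable metric spaces $X_k$; $\Pi(\mu_1,\ldots,\mu_N)$ is the set of Borel probability measures on $\prod_kX_k$ with $k$-th marginal $\mu_k$. The cost $c$ is lower semicontinuous with $c\ge\sum_ka_k(x_k)$, $a_k\in L_1(\mu_k)$; (MKP) is $\inf\{\int c\,d\lambda:\lambda\in\Pi(\mu_1,\ldots,\mu_N)\}$, assumed attained (minimizers = optimal plans). $(\varphi_1,\ldots,\varphi_N)$ is a fixed solution of the dual problem $\sup\{\sum_k\int\varphi_kd\mu_k:\varphi_k\in L_1(\mu_k),\ \sum_k\varphi_k(x_k)\le c\}$. For $2\le j\le N-1$: $\mathcal{P}_j=\{1,\dots,j\}$, $\pi_{\mathcal{P}_j}$ the projection onto $\prod_{k=1}^jX_k$, $c_j(x_1,\ldots,x_j)=\inf_{(x_{j+1},\dots,x_N)}\{c(x_1,\ldots,x_N)-\sum_{k=j+1}^N\varphi_k(x_k)\}$,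 $Z_j=\prod_{k=1}^{j-1}X_k$, $\lambda_1=\mu_1$, $\lambda_N=\lambda$, $c_N=c$. Definition ($(g,P)$-extreme). Let $A,B$ be Polish, $g:A\times B\to\mathbb{R}$, $\rho$ a Borel probability measure on $A\times B$ with marginals $\sigma,\eta$, and $P=\{B_i\}_{i\in I}$, $I\subseteq\mathbb{N}$, an ordered Borel partition of $B$. Let $F_\rho(a)=\{b:(a,b)\in\mathrm{Spt}(\rho)\}$, $\mathrm{Dom}(F_\rho)=\{a:F_\rho(a)\ne\emptyset\}$, $\iota(a)=\min\{i\in I:F_\rho(a)\cap B_i\neq\emptyset\}$ for $a\in\mathrm{Dom}(F_\rho)$, $f_{\rho,g,P}(a)=\operatorname{argmax}\{g(a,b):b\in F_\rho(a)\cap B_{\iota(a)}\}$ and $\mathrm{Dom}(f_{\rho,g,P})=\{a:f_{\rho,g,P}(a)\ne\emptyset\}$. $\rho$ is $(g,P)$-extreme if there exist Borel $A_0\subseteq A$, $B_0\subseteq B$ with $\sigma(A_0)=\eta(B_0)=1$ such that (i) $\mathrm{Dom}(F_\rho)\cap A_0=\mathrm{Dom}(f_{\rho,g,P})\cap A_0$ and (ii) for all $a_1\ne a_2\in A_0$ and all $b_i\in f_{\rho,g,P}(a_i)$: $(F_\rho(a_1)\setminus\{b_1\})\cap(F_\rho(a_2)\setminus\{b_2\})\cap B_0=\emptyset$. *)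

(* Defs.v *)
From HB Require Import structures.
From mathcomp Require Import all_boot all_order all_algebra.
From mathcomp Require Import all_classical all_reals all_analysis.
Set Implicit Arguments. Unset Strict Implicit. Unset Printing Implicit Defensive.
Import Order.TTheory GRing.Theory Num.Theory.
Local Open Scope classical_set_scope.
Local Open Scope ring_scope.

(* equip binary products of pointed topological spaces with the joined structure *)
HB.instance Definition _ (A B : ptopologicalType) := Pointed.on (A * B)%type.

Section Defs.
Variable R : realType.

Definition borel (T : topologicalType) : set (set T) := <<s [set U | open U] >>.
Definition borelT (T : ptopologicalType) := g_sigma_algebraType (@open T).

Definition Spt (T : topologicalType) (rho : set T -> \bar R) : set T :=
  [set p | forall U, open U -> U p -> (0 < rho U)%E].

Definition ordered_borel_partition (T : topologicalType) (I : set nat)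
  (P : nat -> set T) : Prop :=
  [/\ forall i, I i -> borel (P i),
      forall i, I i -> P i !=set0,
      forall i j, I i -> I j -> i <> j -> P i `&` P j = set0
    & \bigcup_(i in I) P i = setT].

Section extreme.
Variables (A B : topologicalType) (g : A -> B -> R) (rho : set (A * B) -> \bar R)
  (I : set nat) (P : nat -> set B).

Definition F_ (a : A) : set B := [set b | Spt rho (a, b)].
Definition DomF : set A := [set a | F_ a !=set0].
Definition iota_ (a : A) (i : nat) : Prop :=
  [/\ I i, F_ a `&` P i !=set0 &
      forall i', I i' -> F_ a `&` P i' !=set0 -> (i <= i')%N].
Definition f_ (a : A) : set B :=
  [set b | exists i, [/\ iota_ a i, F_ a b, P i b &
     forall b', F_ a b' -> P i b' -> g a b' <= g a b]].
Definition Domf : set A := [set a | f_ a !=set0].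

Definition extreme : Prop :=
  exists A0 : set A, exists B0 : set B,
  [/\ borel A0 /\ borel B0, rho (A0 `*` setT) = 1%E, rho (setT `*` B0) = 1%E,
      DomF `&` A0 = Domf `&` A0 &
      forall a1 a2, A0 a1 -> A0 a2 -> a1 <> a2 ->
      forall b1 b2, f_ a1 b1 -> f_ a2 b2 ->
        (F_ a1 `\` [set b1]) `&` (F_ a2 `\` [set b2]) `&` B0 = set0].
End extreme.

Section products.
Variable X : nat -> completePseudoMetricType R.

Fixpoint Zt (j : nat) : ptopologicalType :=
  match j with
  | 0 => X 0
  | j'.+1 => (Zt j' * X j'.+1)%type
  end.

Fixpoint restr_d (j d : nat) : Zt (d + j) -> Zt j :=
  match d return Zt (d + j) -> Zt j with
  | 0 => fun x => x
  | d'.+1 => fun x => @restr_d j d' x.1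
  end.

Definition restr (m n : nat) (H : (m <= n)%N) (x : Zt n) : Zt m :=
  @restr_d m (n - m) (ecast k (Zt k) (esym (subnK H)) x).

Definition last_coord (k : nat) : Zt k -> X k :=
  match k return Zt k -> X k with
  | 0 => fun x => x
  | k'.+1 => fun x => x.2
  end.

Definition coordZ (n : nat) (k : 'I_n.+1) (x : Zt n) : X k :=
  last_coord (restr (ltn_ord k : (k <= n)%N) x).
End products.

Section MKP.
Variables (X : nat -> completePseudoMetricType R) (n : nat).
(* the N = n.+2 marginal spaces are X 0, ..., X n.+1 (0-based indexing) *)
Variables (mu : forall k : nat, probability (borelT (X k)) R)
  (c : Zt X n.+1 -> R).

(* X is Polish: complete (structure), metric (Hausdorff pseudometric), separable *)
Definition polish_family : Prop :=
  forall k, (k <= n.+1)%N ->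
    hausdorff_space (X k) /\ exists D : set (X k), countable D /\ dense D.

Definition Pi (lam : probability (borelT (Zt X n.+1)) R) : Prop :=
  forall (k : 'I_n.+2) (A : set (X k)), borel A ->
    lam (@coordZ X n.+1 k @^-1` A) = mu k A.

Definition cost (lam : probability (borelT (Zt X n.+1)) R) : \bar R :=
  (\int[lam]_x (c x)%:E)%E.

Definition optimal_plan (lam : probability (borelT (Zt X n.+1)) R) : Prop :=
  Pi lam /\ forall lam', Pi lam' -> (cost lam <= cost lam')%E.

Definition L1 (k : nat) (f : X k -> R) : Prop :=
  (mu k).-integrable setT (fun x : borelT (X k) => (f x)%:E).

Definition dual_feasible (psi : forall k, X k -> R) : Prop :=
  (forall k, (k <= n.+1)%N -> L1 (psi k)) /\
  forall x : Zt X n.+1, \sum_(k < n.+2) psi k (coordZ k x) <= c x.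

Definition dual_value (psi : forall k, X k -> R) : \bar R :=
  (\sum_(k < n.+2) \int[mu k]_x (psi k x)%:E)%E.

Definition dual_solution (phi : forall k, X k -> R) : Prop :=
  dual_feasible phi /\
  forall psi, dual_feasible psi -> (dual_value psi <= dual_value phi)%E.

(* c_j on X_0 x ... x X_m (here m = j - 1 in the paper's 1-based indexing) *)
Definition cj (phi : forall k, X k -> R) (m : nat) (Hm : (m <= n.+1)%N)
    (z : Zt X m) : R :=
  inf [set c x - \sum_(k < n.+2 | (m < k)%N) phi k (coordZ k x)
      | x in [set x : Zt X n.+1 | restr Hm x = z]].

Definition proj_plan (lam : probability (borelT (Zt X n.+1)) R) (m : nat)
    (Hm : (m <= n.+1)%N) : set (Zt X m) -> \bar R :=
  fun S => lam (restr Hm @^-1` S).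
End MKP.

End Defs.

(* Main.v *)
(** Two optimal plans have equal projections on X_1 x ... x X_j for every j, by
    induction on j.  Apply the hypotheses to the average of the two plans, which is
    again optimal.

    Complementary slackness: the slack r = c - sum_k phi_k of the dual solution
    vanishes almost everywhere for every optimal plan.  Optimality of phi says that
    the sublinear functional p(f), the infimum of sum_k int psi_k dmu_k over the psi
    with f <= sum_k psi_k + s r for some s >= 0, has p(0) = 0.  A linear functional
    below p is a finitely additive plan giving mass 0 to every set on which r is
    bounded away from 0; because the marginals are tight it is countably additive on
    the algebra of sets approximable by compacts, hence extends to a genuine plan.
    As {r > 0} is a countable union of Borel boxes on which r is bounded below by a
    positive constant, that plan has r = 0 almost everywhere, so its cost is the dual
    value.

    Consequently c_j(x_1, ..., x_j) = sum_{k <= j} phi_k(x_k) on a set of full measure,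
    and comparing values of c_j in a fiber of the j-th projection only involves x_j:
    the fiber is ordered lexicographically, first by block index and then by phi_j.  By
    extremality the points that are not the strict maximum of their fiber form an
    antigraph H, while the strict maxima form a graph G.  If v is the difference of two
    measures with equal marginals carried by G and H, then |v| restricted to G and |v|
    restricted to H have the same marginals; since every point of G is strictly better
    than the points of H in its fiber, comparing the mass of the upper sets of the order
    gives v = 0. *)

Require Import Defs.
From HB Require Import structures.
From mathcomp Require Import all_boot all_order all_algebra.
From mathcomp Require Import all_classical all_reals all_analysis.
From mathcomp Require Import measurable_realfun lra.
Set Implicit Arguments. Unset Strict Implicit. Unset Printing Implicit Defensive.
Import Order.TTheory GRing.Theory Num.Theory.
Local Open Scope classical_set_scope.
Local Open Scope ring_scope.
Import numFieldNormedType.Exports.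

(** * Finitely additive set functions and tightness *)

(** The algebra [D] is a parameter: it consists of all sets for the content produced by Hahn-Banach,
    and of the Borel sets for a probability. *)
Definition additive_on (R : realType) T (D : set (set T)) (m : set T -> R) :=
  [/\ D set0, setC_closed D & setU_closed D] /\
  [/\ m set0 = 0, forall A, D A -> 0 <= m A &
   forall A B, D A -> D B -> A `&` B = set0 -> m (A `|` B) = m A + m B].

Section additive_on_theory.
Context {R : realType} {T : Type} (D : set (set T)) (m : set T -> R).
Hypothesis mD : additive_on D m.

Let D0 : D set0. Proof. by case: mD => -[]. Qed.
Let DC A : D A -> D (~` A). Proof. by case: mD => -[_ + _] _; apply. Qed.
Let DU A B : D A -> D B -> D (A `|` B). Proof. by case: mD => -[_ _ +] _; apply. Qed.

Lemma additive_onI A B : D A -> D B -> D (A `&` B).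
Proof. by move=> a b; rewrite -[A]setCK -[B]setCK -setCU; apply/DC/DU; apply: DC. Qed.

Lemma additive_onD A B : D A -> D B -> D (A `\` B).
Proof. by move=> a b; rewrite setDE; apply: additive_onI => //; exact: DC. Qed.

Lemma additive_on_le A B : D A -> D B -> A `<=` B -> m A <= m B.
Proof.
move=> a b AB; rewrite -[B](setDUK AB).
case: mD => _ [_ m0 mU]; rewrite mU ?setDIK ?lerDl//.
  by apply: m0; exact: additive_onD.
exact: additive_onD.
Qed.

Lemma additive_on_leU A B : D A -> D B -> m (A `|` B) <= m A + m B.
Proof.
move=> a b; case: (mD) => _ [_ m0 mU].
have -> : A `|` B = A `|` (B `\` A) by rewrite setDE setUIr setUv setIT.
rewrite mU ?setDIK//; last exact: additive_onD.
by rewrite lerD2l additive_on_le//; exact: additive_onD.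
Qed.

Lemma additive_on_split A B : D A -> D B -> m A = m (A `&` B) + m (A `\` B).
Proof.
move=> a b; case: (mD) => _ [_ m0 mU].
rewrite -mU ?setUIDK//; first exact: additive_onI.
  exact: additive_onD.
by rewrite setDE setIACA setICr setI0.
Qed.

Lemma additive_on_bigU (A : nat -> set T) n : (forall i, D (A i)) ->
  D (\big[setU/set0]_(i < n) A i) /\
  m (\big[setU/set0]_(i < n) A i) <= \sum_(i < n) m (A i).
Proof.
move=> a; elim: n => [|n [IH1 IH2]].
  by rewrite !big_ord0; case: mD => -[? _ _] [-> _ _].
rewrite !big_ord_recr/=; split; first exact: DU.
by apply: le_trans (additive_on_leU _ _) _ => //; rewrite lerD2r.
Qed.

End additive_on_theory.

(** * Probabilities from measures of total mass one, and image measures *)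

Section probability_of_measure.
Context (R : realType) d (T : measurableType d) (m : {measure set T -> \bar R}).
Hypothesis m1 : m setT = 1%E.

(* The [let] makes the type of the alias remember the hypothesis on which its
   structure instances depend; the same device is used below. *)
Definition unit_measure : set T -> \bar R := let _ := m1 in m.

HB.instance Definition _ := Measure.on unit_measure.
HB.instance Definition _ :=
  Measure_isProbability.Build d T R unit_measure m1.

Lemma probability_of_measure : exists P : probability T R, forall A, P A = m A.
Proof. by exists unit_measure. Qed.

End probability_of_measure.

Section push_measure.
Local Open Scope ereal_scope.
Context d d' (T1 : measurableType d) (T2 : measurableType d') (R : realType).
Variables (m : {measure set T1 -> \bar R}) (f : T1 -> T2).
Hypothesis mf : measurable_fun [set: T1] f.

Definition push_measure : set T2 -> \bar R := let _ := mf in pushforward m f.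

Let push_measure0 : push_measure set0 = 0. Proof. exact: measure0. Qed.

Let push_measure_ge0 A : 0 <= push_measure A. Proof. exact: measure_ge0. Qed.

Let push_measure_sigma_additive : semi_sigma_additive push_measure.
Proof. exact: measure_semi_sigma_additive. Qed.

HB.instance Definition _ := isMeasure.Build _ _ _ push_measure
  push_measure0 push_measure_ge0 push_measure_sigma_additive.

End push_measure.

(** * Inner approximation by compact sets for finitely additive functions *)

Section tight_content.
Context {R : realType} {T : topologicalType}.
Variables (D : set (set T)) (m : set T -> R).
Hypothesis mD : additive_on D m.
Hypothesis hT : hausdorff_space T.
Hypothesis Dcompact : forall K, compact K -> D K.

(** Inner regularity by compact sets, phrased through the mass left outside [K], so that it makes
    sense for a finitely additive [m]. *)
Definition inner_compact (E : set T) := forall e, 0 < e ->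
  exists K, [/\ compact K, K `<=` E & m (E `\` K) <= e].

(** The condition on the complement makes the family an algebra: complements of the compacts found
    there are open sets enclosing [E] closely. *)
Definition tight_set E := [/\ D E, inner_compact E & inner_compact (~` E)].

Let D0 : D set0. Proof. by case: mD => -[]. Qed.
Let DC A : D A -> D (~` A). Proof. by case: mD => -[_ + _] _; apply. Qed.
Let DU A B : D A -> D B -> D (A `|` B). Proof. by case: mD => -[_ _ +] _; apply. Qed.

Lemma inner_compactU A B : D A -> D B ->
  inner_compact A -> inner_compact B -> inner_compact (A `|` B).
Proof.
move=> DA DB a b e e0.
have [K [cK KA mK]] := a _ (divr_gt0 e0 (ltr0Sn _ 1)).
have [L [cL LB mL]] := b _ (divr_gt0 e0 (ltr0Sn _ 1)).
exists (K `|` L); split; [exact: compactU|exact: setUSS|].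
have DK := Dcompact cK; have DL := Dcompact cL.
apply: (@le_trans _ _ (m ((A `\` K) `|` (B `\` L)))).
  apply: (additive_on_le mD).
  - by apply: (additive_onD mD); exact: DU.
  - by apply: DU; exact: (additive_onD mD).
  - by move=> x [[Ax|Bx] /not_orP[nK nL]]; [left|right].
rewrite [leRHS]splitr; apply: le_trans (lerD mK mL).
by apply: (additive_on_leU mD); exact: (additive_onD mD).
Qed.

Lemma inner_compactI A B : D A -> D B ->
  inner_compact A -> inner_compact B -> inner_compact (A `&` B).
Proof.
move=> DA DB a b e e0.
have [K [cK KA mK]] := a _ (divr_gt0 e0 (ltr0Sn _ 1)).
have [L [cL LB mL]] := b _ (divr_gt0 e0 (ltr0Sn _ 1)).
exists (K `&` L); split; [|exact: setISS|].
  by apply: (subclosed_compact _ cK) => //; apply: closedI; exact: compact_closed.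
have DK := Dcompact cK; have DL := Dcompact cL.
apply: (@le_trans _ _ (m ((A `\` K) `|` (B `\` L)))).
  apply: (additive_on_le mD).
  - by apply: (additive_onD mD); exact: (additive_onI mD).
  - by apply: DU; exact: (additive_onD mD).
  - by move=> x [[Ax Bx] /not_andP[nK|nL]]; [left|right].
rewrite [leRHS]splitr; apply: le_trans (lerD mK mL).
by apply: (additive_on_leU mD); exact: (additive_onD mD).
Qed.

Lemma tight_setC A : tight_set A -> tight_set (~` A).
Proof. by move=> [a b c]; split => //; rewrite ?setCK//; exact: DC. Qed.

Lemma tight_setU A B : tight_set A -> tight_set B -> tight_set (A `|` B).
Proof.
move=> [a b c] [a' b' c']; split; [exact: DU|exact: inner_compactU|].
by rewrite setCU; apply: inner_compactI => //; exact: DC.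
Qed.

End tight_content.

(** * Countably additive extension of a tight content *)

Section tight_extension.
Context {R : realType} {T : ptopologicalType}.
Variable m : set T -> R.
Hypothesis mD : additive_on setT m.
Hypothesis hT : hausdorff_space T.
Hypothesis m1 : m setT = 1.
Hypothesis tT : inner_compact m setT.

Definition tight_type : Type := let _ := mD in let _ := hT in let _ := tT in T.

HB.instance Definition _ := Pointed.on tight_type.

Let tight0 : tight_set setT m (set0 : set tight_type).
Proof.
split => //; last by rewrite setC0.
move=> e e0; exists set0; split => //; first exact: compact0.
by rewrite setDv; case: mD => _ [-> _ _]; exact: ltW.
Qed.

Let tightU : setU_closed (tight_set setT m : set (set tight_type)).
Proof. by move=> A B; apply: tight_setU => //. Qed.

Let tightC : setC_closed (tight_set setT m : set (set tight_type)).
Proof. by move=> A; exact: tight_setC. Qed.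

HB.instance Definition _ := @isAlgebraOfSets.Build default_measure_display
  tight_type (tight_set setT m) tight0 tightU tightC.

Definition tight_content (A : set tight_type) : \bar R := (m A)%:E.

Let tight_content_ge0 A : (0 <= tight_content A)%E.
Proof. by rewrite lee_fin; case: mD => _ [_ + _]; apply. Qed.

Let tight_content_add : measure_function.semi_additive tight_content.
Proof.
apply/(measure_function.additive2P).
  by rewrite /tight_content; case: mD => _ [-> _ _].
by move=> A B _ _ AB; rewrite /tight_content; case: mD => _ [_ _ ->].
Qed.

HB.instance Definition _ :=
  isContent.Build _ tight_type R tight_content tight_content_ge0 tight_content_add.

(* Up to [e], a countable cover of a set of the algebra reduces to a finite one:
   replace the set by an inner compact and each member of the cover by the open
   complement of an inner compact of its complement. *)
Let tight_content_sub : measurable_subset_sigma_subadditive tight_content.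
Proof.
move=> A F mF [_ iA _] AF; apply/lee_addgt0Pr => e e0.
have e2 : 0 < e / 2 by rewrite divr_gt0.
have : forall n, exists K, [/\ compact K, K `<=` ~` F n &
    m (~` F n `\` K) <= e / 2 / (2 ^ n.+1)%:R].
  by move=> n; have [_ _] := mF n; apply; rewrite divr_gt0// ltr0n expn_gt0.
move=> /choice[K HK].
have [L [cL LA mL]] := iA _ e2.
have [D' _ LD'] : finite_subset_cover [set: nat] (fun n => ~` K n) L.
  move: cL; rewrite compact_cover; apply.
    by move=> n _; rewrite openC; apply: compact_closed => //; case: (HK n).
  move=> x /LA/AF[n _ Fx]; exists n => //= Kx.
  by case: (HK n) => _ /(_ _ Kx).
pose N := (\max_(i <- finmap.enum_fset D') i).+1.
have LN : L `<=` \big[setU/set0]_(i < N) ~` K i.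
  move=> x /LD'[i /= iD' Kx]; rewrite -(bigcup_mkord N (fun i => ~` K i)); exists i => //=.
  by rewrite /N ltnS; apply: leq_bigmax_seq.
have le1 : m A <= \sum_(i < N) (m (F i) + e / 2 / (2 ^ i.+1)%:R) + e / 2.
  rewrite (additive_on_split mD (B := L))// lerD//.
  apply: (@le_trans _ _ (m L)); first by apply: (additive_on_le mD) => // x [].
  apply: le_trans (additive_on_le mD _ _ LN) _ => //.
  have [_ le2] := additive_on_bigU mD N (A := fun i => ~` K i) (fun=> I).
  apply: le_trans le2 _; apply: ler_sum => i _.
  have [_ KF mK] := HK i.
  rewrite (additive_on_split mD (B := F i))// lerD//.
    by apply: (additive_on_le mD) => // x [].
  apply: le_trans mK; apply: (additive_on_le mD) => // x [Kx Fx].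
  by split.
apply: (@le_trans _ _ ((\sum_(i < N) (m (F i) + e / 2 / (2 ^ i.+1)%:R) + e / 2)%:E)).
  by rewrite lee_fin.
rewrite [X in (_ <= _ + X%:E)%E]splitr !EFinD addeA leeD2r//.
apply: le_trans (epsilon_trick _ _ (ltW e2)); last first.
  by move=> n; exact: tight_content_ge0.
rewrite -sumEFin; apply: le_trans (nneseries_lim_ge N _).
  rewrite big_mkord; apply: lee_sum => i _; by rewrite EFinD.
by move=> i _ _; rewrite adde_ge0// lee_fin divr_ge0// ltW.
Qed.

HB.instance Definition _ := Content_SigmaSubAdditive_isMeasure.Build _ R
  tight_type tight_content tight_content_sub.

(** Caratheodory's extension applies to [m] on the algebra of tight sets; the assumption on Borel
    sets allows the result to be restricted to them. *)
Lemma tight_extension : borel (T := T) `<=` <<s tight_set setT m >> ->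
  exists P : probability (borelT T) R,
    forall A, borel A -> tight_set setT m A -> P A = (m A)%:E.
Proof.
move=> bm.
pose mu := measure_extension (tight_content : {measure set tight_type -> \bar R}).
(* The identity, seen as a measurable map to the Borel sigma-algebra: the image measure under it is
   the restriction to Borel sets. *)
pose f : g_sigma_algebraType (@measurable _ tight_type) -> borelT T := idfun.
have mf : measurable_fun setT f.
  by move=> _ A mA; rewrite setTI; apply: bm.
have muE A : tight_set setT m A -> mu A = (m A)%:E.
  by move=> tA; rewrite /mu /measure_extension measurable_mu_extE.
have tT' : tight_set setT m setT by have := tight_setC mD tight0; rewrite setC0.
have Q1 : push_measure mu mf setT = 1%E.
  by have := muE _ tT'; rewrite m1.
have [P PE] := probability_of_measure Q1.
by exists P => A bA tA; rewrite PE; exact: muE.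
Qed.

End tight_extension.

(** * Regularity of Borel probabilities on Polish spaces and their products *)

Definition has_base (T : topologicalType) := exists O : nat -> set T,
  (forall i, open (O i)) /\
  forall x U, nbhs x U -> exists i, O i x /\ O i `<=` U.

(** * Borel sets *)

Section borel_theory.
Context {T : ptopologicalType}.
Implicit Types A B : set T.

Lemma borel_open A : open A -> borel A.
Proof. exact: sub_sigma_algebra. Qed.

Lemma borel0 : borel (set0 : set T).
Proof. exact: borel_open open0. Qed.

Lemma borelT_set : borel [set: T].
Proof. exact: borel_open openT. Qed.

Lemma borelC A : borel A -> borel (~` A).
Proof. by move=> ?; apply: (@measurableC _ (borelT T)). Qed.

Lemma borelU A B : borel A -> borel B -> borel (A `|` B).
Proof. by move=> ? ?; apply: (@measurableU _ (borelT T)). Qed.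

Lemma borelI A B : borel A -> borel B -> borel (A `&` B).
Proof. by move=> ? ?; apply: (@measurableI _ (borelT T)). Qed.

Lemma borelD A B : borel A -> borel B -> borel (A `\` B).
Proof. by move=> ? ?; apply: (@measurableD _ (borelT T)). Qed.

Lemma borel_bigcup (F : nat -> set T) : (forall i, borel (F i)) ->
  borel (\bigcup_i F i).
Proof. by move=> ?; apply: (@bigcupT_measurable _ (borelT T)). Qed.

Lemma borel_bigcap (F : nat -> set T) : (forall i, borel (F i)) ->
  borel (\bigcap_i F i).
Proof. by move=> ?; apply: (@bigcapT_measurable _ (borelT T)). Qed.

Lemma borel_bigsetU (F : nat -> set T) n : (forall i, borel (F i)) ->
  borel (\big[setU/set0]_(i < n) F i).
Proof.
move=> bF; elim: n => [|n IH]; first by rewrite big_ord0; exact: borel0.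
by rewrite big_ord_recr; exact: borelU.
Qed.

Lemma borel_closed A : closed A -> borel A.
Proof. by move=> cA; rewrite -[A]setCK; apply: borelC; apply: borel_open; exact: closed_openC. Qed.

Lemma borel_compact A : hausdorff_space T -> compact A -> borel A.
Proof. by move=> hT cA; apply: borel_closed; exact: compact_closed. Qed.

End borel_theory.

Lemma continuous_borel (T U : ptopologicalType) (f : T -> U) :
  continuous f -> measurable_fun setT (f : borelT T -> borelT U).
Proof.
move=> cf; apply: (@measurability _ _ (borelT T) (borelT U) setT f (@open U)) => //.
move=> _ [A oA <-]; rewrite setTI; apply: sub_sigma_algebra.
by move/continuousP : cf; apply.
Qed.

Lemma continuous_preimage_borel (T U : ptopologicalType) (f : T -> U) A :
  continuous f -> borel A -> borel (f @^-1` A).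
Proof.
by move=> /continuous_borel mf bA; rewrite -[X in borel X]setTI; apply: mf.
Qed.

(** * Inner regularity for Borel probabilities *)

Section real_probability.
Context {R : realType} {T : ptopologicalType} (P : probability (borelT T) R).

(** Real values instead of extended ones, so that linear arithmetic applies; a probability being
    finite, nothing is lost. *)
Definition rpr (A : set T) : R := fine (P A).

Lemma rprE A : borel A -> P A = (rpr A)%:E.
Proof. by move=> bA; rewrite /rpr fineK// fin_num_measure. Qed.

Lemma rpr_additive : additive_on (borel (T := T)) rpr.
Proof.
split; first by split; [exact: borel0|exact: borelC|exact: borelU].
split; first by rewrite /rpr measure0.
  by move=> A bA; apply: fine_ge0.
move=> A B bA bB AB; rewrite /rpr measureU// fineD// fin_num_measure//.
Qed.

(** Continuity from below along the finite partial unions. *)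
Lemma rpr_bigcup_tail (A : nat -> set T) (e : R) : (forall i, borel (A i)) -> 0 < e ->
  exists N, rpr (\bigcup_i A i `\` \big[setU/set0]_(i < N) A i) <= e.
Proof.
move=> bA e0; set E := \bigcup_i A i.
pose F N := \big[setU/set0]_(i < N) A i.
have bF N : borel (F N) by exact: borel_bigsetU.
have bE : borel E by exact: borel_bigcup.
have FE : \bigcup_N F N = E.
  apply/seteqP; split => x; last first.
    by move=> [i _ Ax]; exists i.+1 => //; rewrite /F big_ord_recr; right.
  move=> [N _]; rewrite /F -(bigcup_mkord N A) => -[i /= iN Ax]; by exists i.
have FN : P \o F @ \oo --> P E.
  rewrite -FE; apply: (@nondecreasing_cvg_mu _ (borelT T)) => //.
    by rewrite FE.
  apply/nondecreasing_seqP => n; rewrite subsetEset /F big_ord_recr.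
  exact: subsetUl.
have {}FN : rpr \o F @ \oo --> rpr E.
  by apply: fine_cvg; rewrite -rprE//.
have /cvgr_gt/(_ (rpr E - e)) := FN; rewrite ltrBlDr ltrDl => /(_ e0) [N _ /(_ N) /= HN].
exists N; have := additive_on_split rpr_additive bE (bF N).
rewrite (_ : E `&` F N = F N); last by apply/setIidPr; rewrite -FE; exact: bigcup_sup.
move=> EE; rewrite -/(F N).
have := HN (leqnn N); rewrite ltrBlDr; lra.
Qed.

Lemma rpr_bigcup_le (A : nat -> set T) (e : R) : (forall i, borel (A i)) -> 0 < e ->
  (forall i, rpr (A i) <= e / (2 ^ i.+1)%:R) -> rpr (\bigcup_i A i) <= e.
Proof.
move=> bA e0 Ae; rewrite -lee_fin -rprE; last exact: borel_bigcup.
apply: (@le_trans _ _ (\sum_(0 <= i <oo) P (A i))%E).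
  apply: (@measure_sigma_subadditive _ _ (borelT T)) => //.
  exact: (@bigcupT_measurable _ (borelT T)).
apply: le_trans (epsilon_trick0 xpredT (ltW e0)).
by apply: lee_nneseries => // i _; rewrite rprE// lee_fin.
Qed.

(** Up to [e / 2] the union is a finite one, and finitely many compacts have a compact union. *)
Lemma inner_compact_bigcup (A : nat -> set T) : hausdorff_space T ->
  (forall i, borel (A i)) ->
  (forall i, inner_compact rpr (A i)) -> inner_compact rpr (\bigcup_i A i).
Proof.
move=> hT bA iA e e0.
have e2 := divr_gt0 e0 (ltr0Sn _ 1).
have [N HN] := rpr_bigcup_tail bA e2.
have bA' n : borel (\big[setU/set0]_(i < n) A i).
  by exact: borel_bigsetU.
have [K [cK KA mK]] : exists K, [/\ compact K, K `<=` \big[setU/set0]_(i < N) A i &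
    rpr (\big[setU/set0]_(i < N) A i `\` K) <= e / 2].
  have : inner_compact rpr (\big[setU/set0]_(i < N) A i); last exact.
  elim: N {HN} => [|N IH].
    rewrite big_ord0 => d d0; exists set0; split => //; first exact: compact0.
    by rewrite setDv /rpr measure0 ltW.
  rewrite big_ord_recr; apply: (inner_compactU rpr_additive) => //.
  by move=> K cK; exact: borel_compact.
have bK := borel_compact hT cK.
exists K; split => //.
  apply: (subset_trans KA); rewrite -(bigcup_mkord N A) => x [i _ Ax]; by exists i.
have := additive_on_leU rpr_additive
  (borelD (borel_bigcup bA) (bA' N)) (borelD (bA' N) bK).
have : rpr (\bigcup_i A i `\` K) <=
  rpr ((\bigcup_i A i `\` \big[setU/set0]_(i < N) A i) `|` (\big[setU/set0]_(i < N) A i `\` K)).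
  apply: (additive_on_le rpr_additive).
  - by apply: borelD => //; exact: borel_bigcup.
  - by apply: borelU; apply: borelD => //; exact: borel_bigcup.
  - move=> x [Ax Kx]; have [Nx|nNx] := pselect ((\big[setU/set0]_(i < N) A i) x).
      by right.
    by left.
lra.
Qed.

(** Compacts chosen with errors [e / 2 ^ (n + 1)] have a compact intersection, and the errors add up
    to at most [e]. *)
Lemma inner_compact_bigcap (A : nat -> set T) : hausdorff_space T ->
  (forall i, borel (A i)) ->
  (forall i, inner_compact rpr (A i)) -> inner_compact rpr (\bigcap_i A i).
Proof.
move=> hT bA iA e e0.
have : forall n, exists K, [/\ compact K, K `<=` A n &
    rpr (A n `\` K) <= e / (2 ^ n.+1)%:R].
  by move=> n; apply: iA; rewrite divr_gt0// ltr0n expn_gt0.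
move=> /choice[K HK].
have bK i : borel (K i) by apply: borel_compact => //; case: (HK i).
exists (\bigcap_i K i); split.
- case: (HK 0%N) => cK _ _; apply: (subclosed_compact _ cK).
    by apply: closed_bigI => i _; apply: compact_closed => //; case: (HK i).
  by move=> x; apply.
- by move=> x Kx i _; case: (HK i) => _ + _; apply; exact: Kx.
- apply: (@le_trans _ _ (rpr (\bigcup_i (A i `\` K i)))).
    apply: (additive_on_le rpr_additive).
    + by apply: borelD; exact: borel_bigcap.
    + by apply: borel_bigcup => i; exact: borelD.
    + move=> x [Ax /existsNP[i /not_implyP[_ Kx]]]; exists i => //.
      by split => //; exact: Ax.
  apply: rpr_bigcup_le => //; first by move=> i; exact: borelD.
  by move=> i; case: (HK i).
Qed.

Lemma inner_compact_closed A : hausdorff_space T -> inner_compact rpr setT ->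
  closed A -> inner_compact rpr A.
Proof.
move=> hT iT cA e /iT[K [cK _ mK]]; exists (A `&` K); split => //.
  by apply: (subclosed_compact _ cK) => //; apply: closedI => //; exact: compact_closed.
apply: le_trans mK; have bK := borel_compact hT cK; have bA := borel_closed cA.
apply: (additive_on_le rpr_additive).
- by apply: borelD => //; exact: borelI.
- by apply: borelD => //; exact: borelT_set.
- by move=> x [Ax /not_andP[]].
Qed.

(** The sets that are inner approximable together with their complement form a sigma-algebra, so it
    suffices to treat generators. *)
Lemma tight_set_borel (G : set (set T)) : hausdorff_space T ->
  inner_compact rpr setT ->
  borel (T := T) `<=` <<s G >> -> G `<=` tight_set (borel (T := T)) rpr ->
  borel (T := T) `<=` tight_set (borel (T := T)) rpr.
Proof.
move=> hT iT bG Gt; apply: (subset_trans bG); apply: smallest_sub => //.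
split.
- split; [exact: borel0| |by rewrite setC0].
  move=> e e0; exists set0; split => //; first exact: compact0.
  by rewrite setDv /rpr measure0 ltW.
- move=> A tA; rewrite setTD; apply: (tight_setC rpr_additive) => //.
- move=> A tA; split.
  + by apply: borel_bigcup => i; case: (tA i).
  + by apply: inner_compact_bigcup => // i; case: (tA i).
  + rewrite setC_bigcup; apply: inner_compact_bigcap => // i; case: (tA i) => //.
    by move=> ? _ _; exact: borelC.
Qed.

End real_probability.

(** [Zt] carries a topology but no metric, so completeness is traded for these topological
    properties, which pass to products. *)
Definition radon_space (R : realType) (T : ptopologicalType) :=
  [/\ hausdorff_space T, has_base T &
  forall (P : probability (borelT T) R) E, borel E -> inner_compact (rpr P) E].

Lemma push_probability (R : realType) (T U : ptopologicalType) (f : T -> U)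
    (P : probability (borelT T) R) : continuous f ->
  exists Q : probability (borelT U) R, forall E, Q E = P (f @^-1` E).
Proof.
move=> cf; have h : push_measure P (continuous_borel cf) setT = 1%E.
  exact: probability_setT.
by have [Q QE] := probability_of_measure h; exists Q => E; rewrite QE.
Qed.

Lemma dense_sequence (T : ptopologicalType) (D : set T) : countable D -> dense D ->
  exists d : nat -> T, forall O, open O -> O !=set0 -> exists i, O (d i).
Proof.
move=> cD dD.
have [D0|D0] := eqVneq D set0.
  have [|x []] := dD setT _ openT; first by exists point.
  by rewrite D0.
move: cD => /pfcard_geP[/eqP|[d]]; first by rewrite (negPf D0).
exists d => O oO O0; have [x [Ox Dx]] := dD _ O0 oO.
have [i _ dix] := 'surj_d Dx.
by exists i; rewrite dix.
Qed.

(** * Regularity on complete separable metric spaces *)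

Section polish.
Context {R : realType} {T : completePseudoMetricType R}.
Hypothesis hT : hausdorff_space T.
Variable d : nat -> T.
Hypothesis dd : forall O, open O -> O !=set0 -> exists i, O (d i).

Let ball_d (e : R) x : 0 < e -> exists i, ball (d i) e x.
Proof.
move=> e0; have [|i /interior_subset/ball_sym ?] := dd (open_interior (ball x e)).
  by exists x; exact: nbhsx_ballx.
by exists i.
Qed.

Lemma has_base_dense : has_base T.
Proof.
exists (fun k => if (unpickle k : option (nat * nat)) is Some ij
  then interior (ball (d ij.1) (ij.2.+1%:R^-1 : R)) else set0); split.
  by move=> k; case: unpickle => [[i j]|]; [exact: open_interior|exact: open0].
move=> x U /nbhs_ballP[e /= e0 eU].
have [|j] := @ltr_add_invr R 0%R (e / 2) _; first by rewrite divr_gt0.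
rewrite add0r; set r : R := j.+1%:R^-1 => re.
have r0 : 0 < r by rewrite invr_gt0.
have r20 : 0 < r / 2 by rewrite divr_gt0.
have [|i /interior_subset dx] := dd (open_interior (ball x (r / 2))).
  by exists x; exact: nbhsx_ballx.
exists (pickle (i, j)); rewrite pickleK /=; split.
  apply: (filterS _ (nbhsx_ballx x _ r20)) => z xz.
  by apply: ball_split xz; exact: ball_sym.
move=> z /interior_subset dz; apply: eU; apply: (le_ball _ (ball_triangle dx dz)).
by rewrite -/r; lra.
Qed.

(** Ulam's argument: for each [n], finitely many closed balls of radius [1 / (n + 1)] miss little
    mass; the intersection of their unions is closed and totally bounded, hence compact by
    completeness. *)
Lemma inner_compact_polish (P : probability (borelT T) R) :
  inner_compact (rpr P) setT.
Proof.
move=> e e0.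
pose B n i := closure (ball (d i) (n.+1%:R^-1 : R)).
have bB n i : borel (B n i) by apply: borel_closed; exact: closed_closure.
have BT n : \bigcup_i B n i = setT.
  apply/seteqP; split => // x _; have [|i di] := @ball_d n.+1%:R^-1 x.
    by rewrite invr_gt0.
  by exists i => //; exact: subset_closure.
have : forall n, exists N, rpr P (~` \big[setU/set0]_(i < N) B n i) <= e / (2 ^ n.+1)%:R.
  move=> n; have [|N] := rpr_bigcup_tail P (bB n) (e := e / (2 ^ n.+1)%:R).
    by rewrite divr_gt0// ltr0n expn_gt0.
  by rewrite BT setTD => ?; exists N.
move=> /choice[N HN].
pose F n := \big[setU/set0]_(i < N n) B n i.
have cF n : closed (F n).
  by apply: closed_bigsetU => i _; exact: closed_closure.
exists (\bigcap_n F n); split => //; last first.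
  rewrite setTD setC_bigcap; apply: rpr_bigcup_le => // i.
  by apply: borelC; exact: borel_closed.
rewrite compact_ultra => G GU GF.
have GP : ProperFilter G by exact: ultra_proper.
(* An ultrafilter containing a finite union contains one of its members, here a small ball for each
   [n], so it is Cauchy. *)
have GB n : exists i, G (B n i).
  have : G (F n) by apply: filterS GF => x; apply.
  rewrite /F; elim: (N n) => [|k IH].
    by rewrite big_ord0 => /filter_not_empty.
  rewrite big_ord_recr /= => GU'.
  have [GA|GA] := in_ultra_setVsetC (B n k) GU; first by exists k.
  by apply: IH; apply: filterS (filterI GU' GA) => x [[]].
have /cauchy_cvg/cvg_ex[l Gl] : cauchy G.
  apply: cauchy_exP => r r0.
  have [|n] := @ltr_add_invr R 0%R (r / 2) _; first by rewrite divr_gt0.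
  rewrite add0r => nr; have [i GBi] := GB n.
  exists (d i); apply: filterS GBi => x /(_ (ball x (r / 2))).
  case; first by apply: nbhsx_ballx; rewrite divr_gt0.
  move=> y [dy xy]; apply: (@ball_splitl _ _ y) => //.
  exact: (le_ball (ltW nr)).
exists l; split => // n _; apply: (cF n l) => V /Gl GV.
have [z [Vz Fz]] := filter_ex (filterI GV GF).
by exists z; split => //; exact: Fz.
Qed.

Lemma radon_polish : radon_space R T.
Proof.
have [V_ [oO bO]] := has_base_dense.
split => //; first by exists V_.
move=> P E bE; have iT := inner_compact_polish P.
suff : tight_set (borel (T := T)) (rpr P) E by case.
apply: (tight_set_borel (G := [set U | open U])) bE => // U /= oU.
split; [exact: borel_open| |]; last first.
  by apply: inner_compact_closed => //; exact: open_closedC.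
(* By regularity [U] is the union of the closures of basic sets that it contains, hence a countable
   union of closed sets. *)
pose F i := if pselect (closure (V_ i) `<=` U) then closure (V_ i) else set0.
have cF i : closed (F i).
  by rewrite /F; case: pselect => ?; [exact: closed_closure|exact: closed0].
have UE : U = \bigcup_i F i.
  apply/seteqP; split => x; last by move=> [i _]; rewrite /F; case: pselect => // h /h.
  move=> Ux; have [V nV VU] := @uniform_regular T x U (open_nbhs_nbhs (conj oU Ux)).
  have [i [Oix OiV]] := bO x V nV.
  exists i => //; rewrite /F; case: pselect => [h|]; first exact: subset_closure.
  by case; apply: subset_trans VU; exact: closureS.
rewrite [X in inner_compact _ X]UE.
apply: inner_compact_bigcup => // i; first exact: borel_closed.
exact: inner_compact_closed.
Qed.

End polish.

(** * Binary products *)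

Section product.
Context {R : realType} {A B : ptopologicalType}.

Lemma open_rectangle (U : set A) (V : set B) : open U -> open V -> open (U `*` V).
Proof.
move=> oU oV; rewrite openE => -[x y] [/= Ux Vy].
by exists (U, V) => //=; split; exact: open_nbhs_nbhs.
Qed.

Lemma has_base_prod : has_base A -> has_base B -> has_base (A * B)%type.
Proof.
move=> [V_ [oO bO]] [W_ [oQ bQ]].
exists (fun k => if (unpickle k : option (nat * nat)) is Some ij
  then V_ ij.1 `*` W_ ij.2 else set0); split.
  by move=> k; case: unpickle => [[i j]|]; [exact: open_rectangle|exact: open0].
move=> [x y] U [[V W] /= [nV nW] VWU].
have [i [Ox OV]] := bO _ _ nV; have [j [Qy QW]] := bQ _ _ nW.
exists (pickle (i, j)); rewrite pickleK /=; split => //.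
by move=> [a b] [/= /OV Va /QW Wb]; apply: VWU.
Qed.

Definition borel_rectangles := [set E : set (A * B) |
  exists E1 E2, [/\ borel E1, borel E2 & E = E1 `*` E2]].

(** With countable bases, an open set is a countable union of open rectangles. *)
Lemma borel_prod : has_base A -> has_base B ->
  borel (T := (A * B)%type) `<=` <<s borel_rectangles >>.
Proof.
move=> [V_ [oO bO]] [W_ [oQ bQ]]; apply: smallest_sub; first exact: smallest_sigma_algebra.
move=> U /= oU.
have -> : U = \bigcup_(k in [set k : nat * nat | V_ k.1 `*` W_ k.2 `<=` U]) (V_ k.1 `*` W_ k.2).
  apply/seteqP; split => x; last by move=> [k kU /kU].
  move=> Ux; have [[V W] /= [nV nW] VWU] := open_nbhs_nbhs (conj oU Ux).
  have [i [Ox OV]] := bO _ _ nV; have [j [Qy QW]] := bQ _ _ nW.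
  exists (i, j) => //= -[a b] [/= /OV Va /QW Wb]; exact: VWU.
rewrite bigcup_mkcond.
apply: (@countable_bigcupT_measurable _ (g_sigma_algebraType borel_rectangles)) => // k.
case: ifP => _; last exact: measurable0.
apply: sub_sigma_algebra; exists (V_ k.1), (W_ k.2).
by split => //; exact: borel_open.
Qed.

Lemma hausdorff_prod : hausdorff_space A -> hausdorff_space B ->
  hausdorff_space (A * B)%type.
Proof.
move=> hA hB [a b] [a' b'] cl; congr pair.
  apply: hA => U V nU nV.
  have [||[x y] [/= [Ux _] [Vx _]]] := cl (U `*` setT) (V `*` setT).
    by exists (U, setT) => //=; split => //; exact: filterT.
    by exists (V, setT) => //=; split => //; exact: filterT.
  by exists x.
apply: hB => U V nU nV.
have [||[x y] [/= [_ Uy] [_ Vy]]] := cl (setT `*` U) (setT `*` V).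
  by exists (setT, U) => //=; split => //; exact: filterT.
  by exists (setT, V) => //=; split => //; exact: filterT.
by exists y.
Qed.

(** In a rectangle, a product of compacts chosen for the two marginals of [P] leaves out little
    mass; the complement of a rectangle is a union of two rectangles, which settles the
    generators. *)
Lemma radon_prod : radon_space R A -> radon_space R B -> radon_space R (A * B)%type.
Proof.
move=> [hA bA rA] [hB bB rB].
have hAB := hausdorff_prod hA hB.
split => //; first exact: has_base_prod.
move=> P E bE.
have cf : continuous (fst : A * B -> A) by move=> x; exact: cvg_fst.
have cs : continuous (snd : A * B -> B) by move=> x; exact: cvg_snd.
have [P1 P1E] := push_probability P cf.
have [P2 P2E] := push_probability P cs.
have rect E1 E2 : borel E1 -> borel E2 -> borel (E1 `*` E2) /\ inner_compact (rpr P) (E1 `*` E2).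
  move=> b1 b2.
  have bp (F1 : set A) (F2 : set B) : borel F1 -> borel F2 -> borel (F1 `*` F2).
    move=> c1 c2; apply: (borelI (A := fst @^-1` F1) (B := snd @^-1` F2)).
      exact: continuous_preimage_borel.
    exact: continuous_preimage_borel.
  split; first exact: bp.
  move=> e e0.
  have [K [cK KE PK]] := rA P1 _ b1 _ (divr_gt0 e0 (ltr0Sn _ 1)).
  have [L [cL LE PL]] := rB P2 _ b2 _ (divr_gt0 e0 (ltr0Sn _ 1)).
  have bK := borel_compact hA cK; have bL := borel_compact hB cL.
  exists (K `*` L); split; [exact: compact_setX|by move=> x [/KE ? /LE]|].
  move: PK PL; rewrite /rpr P1E P2E => PK PL.
  have bK' := continuous_preimage_borel cf (borelD b1 bK).
  have bL' := continuous_preimage_borel cs (borelD b2 bL).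
  apply: (@le_trans _ _ (rpr P (fst @^-1` (E1 `\` K) `|` snd @^-1` (E2 `\` L)))).
    apply: (additive_on_le (rpr_additive P)).
    - by apply: borelD; exact: bp.
    - exact: borelU.
    - by move=> x [[/= x1 x2] /not_andP[]]; [left|right].
  rewrite [leRHS]splitr; apply: le_trans (lerD PK PL).
  exact: (additive_on_leU (rpr_additive P)).
suff : tight_set (borel (T := (A * B)%type)) (rpr P) E by case.
apply: (tight_set_borel hAB _ (borel_prod bA bB)) bE.
  by rewrite -setXTT; apply rect; exact: borelT_set.
move=> _ [E1 [E2 [b1 b2 ->]]]; split; try by apply rect.
have -> : ~` (E1 `*` E2) = (~` E1 `*` setT) `|` (E1 `*` ~` E2).
  apply/seteqP; split => -[x y] /=.
    move=> nE; have [E1x|E1x] := pselect (E1 x); last by left.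
    by right; split => // E2y; apply: nE.
  by move=> [[? _] []|[? ?] []].
apply: (inner_compactU (rpr_additive P)).
- by move=> K; exact: borel_compact.
- by apply rect; [exact: borelC|exact: borelT_set].
- by apply rect => //; exact: borelC.
- by apply rect; [exact: borelC|exact: borelT_set].
- by apply rect => //; exact: borelC.
Qed.

End product.

(** * Lusin's theorem for sequences of sets *)

Section lusin.
Context {R : realType} {T : ptopologicalType}.
Hypothesis rT : radon_space R T.
Variable P : probability (borelT T) R.

Let hT : hausdorff_space T. Proof. by case: rT. Qed.

(** Lusin's theorem for the indicators of the [V t]: each [V t] is relatively clopen in [K], as it
    cuts [K] into two compact pieces. *)
Lemma lusin_compact (E : set T) (V : nat -> set T) (e : R) : borel E ->
  (forall t, borel (V t)) -> 0 < e ->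
  exists K, [/\ compact K, K `<=` E, rpr P (E `\` K) <= e &
    forall t, compact (K `&` V t) /\ compact (K `\` V t)].
Proof.
move=> bE bV e0; case: rT => _ _ rP.
(* Index 0 handles [E] itself, with [set0] as second piece; index [t.+1] handles [V t] and its
   complement. *)
pose F t := if t is t'.+1 then V t' else E.
pose F' t := if t is t'.+1 then ~` V t' else set0.
have bF t : borel (F t) by case: t.
have bF' t : borel (F' t) by case: t => [|t]; [exact: borel0|exact: borelC].
have iF t : exists K, [/\ compact K, K `<=` F t & rpr P (F t `\` K) <= e / (2 ^ t.+1)%:R / 2].
  by apply: rP => //; rewrite !divr_gt0// ltr0n expn_gt0.
have iF' t : exists K, [/\ compact K, K `<=` F' t & rpr P (F' t `\` K) <= e / (2 ^ t.+1)%:R / 2].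
  by apply: rP => //; rewrite !divr_gt0// ltr0n expn_gt0.
have [K HK] := choice iF; have [L HL] := choice iF'.
have cK t : compact (K t) by case: (HK t).
have cL t : compact (L t) by case: (HL t).
have bK t := borel_compact hT (cK t); have bL t := borel_compact hT (cL t).
pose M := \bigcap_t (K t `|` L t).
have clM : closed M by apply: closed_bigI => t _; apply: compact_closed => //; exact: compactU.
have L0 : L 0%N `<=` set0 by case: (HL 0%N).
have ME : M `<=` E.
  by move=> x /(_ 0%N Logic.I)[|/L0//]; case: (HK 0%N) => _ + _; apply.
have cM : compact M.
  apply: (subclosed_compact clM (cK 0%N)) => x /(_ 0%N Logic.I)[//|/L0//].
exists M; split => //.
- apply: (@le_trans _ _ (rpr P (\bigcup_t ((F t `\` K t) `|` (F' t `\` L t))))).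
    apply: (additive_on_le (rpr_additive P)).
    + by apply: borelD => //; exact: borel_closed.
    + by apply: borel_bigcup => t; apply: borelU; exact: borelD.
    + move=> x [Ex /existsNP[t /not_implyP[_ /not_orP[nK nL]]]]; exists t => //.
      case: t nK nL => [|t] nK nL; first by left.
      by have [Vx|Vx] := pselect (V t x); [left|right].
  apply: rpr_bigcup_le => // t; first by apply: borelU; exact: borelD.
  rewrite [leRHS]splitr; case: (HK t) => _ _ h1; case: (HL t) => _ _ h2.
  apply: le_trans (lerD h1 h2); apply: (additive_on_leU (rpr_additive P)); exact: borelD.
- move=> t; have [_ KV _] := HK t.+1; have [_ LV _] := HL t.+1; split.
    rewrite (_ : M `&` V t = M `&` K t.+1); last first.
      apply/seteqP; split => x [Mx Vx]; split => //; last exact: KV.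
      by have [//|/LV] := Mx t.+1 Logic.I.
    by apply: (subclosed_compact _ cM) => //; apply: closedI => //; exact: compact_closed.
  rewrite (_ : M `\` V t = M `&` L t.+1); last first.
    apply/seteqP; split => x [Mx Vx]; split => //; last exact: LV.
    by have [/KV|] := Mx t.+1 Logic.I.
  by apply: (subclosed_compact _ cM) => //; apply: closedI => //; exact: compact_closed.
Qed.

(** The compacts obtained for the errors [1 / (n + 1)] together exhaust [E] up to a null set. *)
Lemma lusin_sigma_compact (E : set T) (V : nat -> set T) : borel E ->
  (forall t, borel (V t)) ->
  exists K : nat -> set T, [/\ forall n, compact (K n), forall n, K n `<=` E,
    rpr P (E `\` \bigcup_n K n) = 0 &
    forall n t, compact (K n `&` V t) /\ compact (K n `\` V t)].
Proof.
move=> bE bV.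
have : forall n : nat, exists K, [/\ compact K, K `<=` E, rpr P (E `\` K) <= n.+1%:R^-1 &
    forall t, compact (K `&` V t) /\ compact (K `\` V t)].
  by move=> n; apply: lusin_compact => //; rewrite invr_gt0.
move=> /choice[K HK].
have bK n : borel (K n) by apply: borel_compact => //; case: (HK n).
exists K; split; try by move=> n; case: (HK n).
have bD : borel (E `\` \bigcup_n K n) by apply: borelD => //; exact: borel_bigcup.
apply/eqP; rewrite eq_le; apply/andP; split; last first.
  by case: (rpr_additive P) => _ [_ + _]; apply.
apply/ler_addgt0Pr => e e0; rewrite add0r.
have [n] := @ltr_add_invr R 0%R e e0; rewrite add0r => /ltW; apply: le_trans.
have [_ _ h _] := HK n; apply: le_trans h.
apply: (additive_on_le (rpr_additive P)) => //; first exact: borelD.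
by move=> x [Ex Kx]; split => // Kn; apply: Kx; exists n.
Qed.

End lusin.

(** * Measurability of the set of dominated points *)

Lemma closed_fiber_product (T A : topologicalType) (p : T -> A) :
  hausdorff_space A -> continuous p ->
  closed [set z : T * T | p z.1 = p z.2].
Proof.
move=> hA cp [x y] cl /=; apply: hA => U V nU nV.
have [|[x' y'] /= [pE [Ux Vy]]] := cl (p @^-1` U `*` p @^-1` V).
  by exists (p @^-1` U, p @^-1` V) => //=; split; exact: cp.
by exists (p x'); split => //; rewrite pE.
Qed.

Section dominated_points.
Context {R : realType} {T A : ptopologicalType}.
Hypothesis rT : radon_space R T.
Hypothesis hA : hausdorff_space A.
Variable p : T -> A.
Hypothesis cp : continuous p.
Variable V : nat -> set T.

(* [V] lists upper sets of a total preorder: a point is dominated when it is not the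
   strict maximum of its fiber in [S]. *)
Definition dominated (S : set T) := [set x | S x /\ exists y,
  [/\ S y, p y = p x, y <> x & forall t, V t x -> V t y]].

(** The dominated points form a projection, for which being Borel is not automatic. On a countable
    union of compacts where the base sets and the [V t] are clopen, the pairs in question form a
    countable union of compacts, and so does their projection. *)
Lemma borel_dominated (P1 P2 : probability (borelT T) R) (S : set T) :
  borel S -> (forall t, borel (V t)) ->
  exists S', [/\ borel S', S' `<=` S, rpr P1 (S `\` S') = 0,
    rpr P2 (S `\` S') = 0 & borel (dominated S')].
Proof.
move=> bS bV; case: (rT) => hT [W_ [oW bW]] _.
(* Even indices list a base of the topology and odd ones the sets [V], so that Lusin's theorem
   treats both at once. *)
pose V' k := if odd k then V k./2 else W_ k./2.
have V'V t : V' t.*2.+1 = V t by rewrite /V' /= odd_double /= uphalf_double.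
have V'W t : V' t.*2 = W_ t by rewrite /V' odd_double doubleK.
have bV' k : borel (V' k).
  by rewrite /V'; case: ifP => _ //; exact: borel_open.
have [K1 [cK1 K1S PK1 K1V]] := lusin_sigma_compact rT P1 bS bV'.
have [K2 [cK2 K2S PK2 K2V]] := lusin_sigma_compact rT P2 bS bV'.
(* The compacts for [P1] and for [P2] are interleaved, so that [S'] has full measure in [S] for
   both. *)
pose K k := if odd k then K1 k./2 else K2 k./2.
have cK k : compact (K k) by rewrite /K; case: ifP.
have bK k : borel (K k) by exact: borel_compact.
have KV k t : compact (K k `&` V' t) /\ compact (K k `\` V' t).
  by rewrite /K; case: ifP.
have KS k : K k `<=` S by rewrite /K; case: ifP.
pose S' := \bigcup_k K k.
have bS' : borel S' by exact: borel_bigcup.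
have null (P : probability (borelT T) R) (L : nat -> set T) :
    (forall k, L k `<=` S') -> (forall k, compact (L k)) ->
    rpr P (S `\` \bigcup_k L k) = 0 -> rpr P (S `\` S') = 0.
  move=> LS cL PL; apply/eqP; rewrite eq_le; apply/andP; split; last first.
    by case: (rpr_additive P) => _ [_ + _]; apply; exact: borelD.
  rewrite -PL; apply: (additive_on_le (rpr_additive P)).
  - exact: borelD.
  - apply: borelD => //; apply: borel_bigcup => k; exact: borel_compact.
  - by move=> x [Sx S'x]; split => // -[k _ Lx]; apply/S'x/LS/Lx.
exists S'; split => //.
- by move=> x [k _ /KS].
- apply: (null _ K1) => // k x Kx; exists k.*2.+1 => //.
  by rewrite /K /= odd_double /= uphalf_double.
- apply: (null _ K2) => // k x Kx; exists k.*2 => //.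
  by rewrite /K odd_double doubleK.
have hTT := hausdorff_prod hT hT.
(* Pairs in one fiber whose second point dominates the first. That they differ is expressed by a
   separating base set [W_ i], which is a compact condition. *)
pose D n m i := fst @` (((K n `&` W_ i) `*` (K m `\` W_ i)) `&`
  [set z : T * T | p z.1 = p z.2] `&`
  \bigcap_t (((K n `\` V t) `*` K m) `|` (K n `*` (K m `&` V t)))).
have cD n m i : compact (D n m i).
  apply: continuous_compact; first by apply: continuous_subspaceT => z; exact: cvg_fst.
  have c1 : compact ((K n `&` W_ i) `*` (K m `\` W_ i)).
    by apply: compact_setX; rewrite -V'W; case: (KV n i.*2); case: (KV m i.*2).
  apply: (subclosed_compact _ c1); last by move=> z [[]].
  apply: closedI; first apply: closedI.
  - exact: compact_closed.
  - exact: closed_fiber_product.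
  - apply: closed_bigI => t _; apply: compact_closed => //.
    by apply: compactU; apply: compact_setX => //; rewrite -V'V; case: (KV n t.*2.+1); case: (KV m t.*2.+1).
have -> : dominated S' = \bigcup_n \bigcup_m \bigcup_i D n m i.
  apply/seteqP; split => x.
    move=> [[n _ Kx] [y [[m _ Ky] pyx yx Vxy]]].
    have : exists i, W_ i x /\ ~ W_ i y.
      apply: contrapT => /forallNP h; apply: yx; apply: hT => U U' nU nU'.
      have [i [Wx WU]] := bW _ _ nU'.
      have /not_andP[//|/contrapT Wy] := h i.
      by exists y; split; [exact: nbhs_singleton|exact: WU].
    move=> [i [Wx Wy]]; exists n => //; exists m => //; exists i => //.
    exists (x, y) => //; split; first by split => //=; split.
    move=> t _; have [Vx|Vx] := pselect (V t x).
      by right; split => //; split => //=; exact: Vxy.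
    by left.
  move=> [n _ [m _ [i _ [[x' y] [[[/= [Kx Wx] [Ky Wy]] pE] Vxy] <-]]]].
  split; first by exists n.
  exists y; split => //; first by exists m.
    by move=> yx; apply: Wy; rewrite yx.
  by move=> t Vx; case: (Vxy t Logic.I) => [[[_ /= /(_ Vx)]]|[_ []]].
by do 3 (apply: borel_bigcup => ?); exact: borel_compact.
Qed.

End dominated_points.

(** * Uniqueness of measures carried by a graph and an antigraph *)

Section signed_difference.
Context {R : realType} {T : ptopologicalType}.
Variables P1 P2 : probability (borelT T) R.

Definition pdiff (E : set T) : R := rpr P1 E - rpr P2 E.

Lemma pdiff_split A B : borel A -> borel B ->
  pdiff A = pdiff (A `&` B) + pdiff (A `\` B).
Proof.
move=> bA bB; rewrite /pdiff.
have := additive_on_split (rpr_additive P1) bA bB.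
by have := additive_on_split (rpr_additive P2) bA bB; lra.
Qed.

Lemma pdiff_null A B : borel A -> borel B -> B `<=` A ->
  rpr P1 A = 0 -> rpr P2 A = 0 -> pdiff B = 0.
Proof.
move=> bA bB BA A1 A2; rewrite /pdiff.
have := additive_on_le (rpr_additive P1) bB bA BA.
have := additive_on_le (rpr_additive P2) bB bA BA.
case: (rpr_additive P1) => _ [_ /(_ _ bB) + _].
by case: (rpr_additive P2) => _ [_ /(_ _ bB) + _]; lra.
Qed.

Lemma pdiff_hahn : exists Q, [/\ borel Q,
  forall E, borel E -> E `<=` Q -> 0 <= pdiff E &
  forall E, borel E -> E `<=` ~` Q -> pdiff E <= 0].
Proof.
pose nu := cadd (charge_of_finite_measure P1) (copp (charge_of_finite_measure P2)).
have nuE E : borel E -> nu E = (pdiff E)%:E.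
  by move=> bE; rewrite /pdiff EFinB -!rprE.
have [Q [N [[mQ Q0] [mN N0] QN _]]] := Hahn_decomposition nu.
exists Q; split => // E bE EQ.
  by rewrite -lee_fin -nuE//; apply: Q0.
rewrite -lee_fin -nuE//; apply: N0 => // x /EQ Qx.
by have [] : (Q `|` N) x by rewrite QN.
Qed.

End signed_difference.

(** * Total variation, and sets on which a projection is injective *)

Section variation.
Context {R : realType} {T : ptopologicalType}.
Variables P1 P2 : probability (borelT T) R.
Variable Q : set T.
Hypothesis bQ : borel Q.
Hypothesis Qpos : forall E, borel E -> E `<=` Q -> 0 <= pdiff P1 P2 E.
Hypothesis Qneg : forall E, borel E -> E `<=` ~` Q -> pdiff P1 P2 E <= 0.

Local Notation v := (pdiff P1 P2).

(** The total variation of the difference, expressed by means of a Hahn set [Q]. *)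
Definition pvar (E : set T) : R := v (E `&` Q) - v (E `\` Q).
Local Notation w := pvar.

Lemma pvar_split A B : borel A -> borel B -> w A = w (A `&` B) + w (A `\` B).
Proof.
move=> bA bB; rewrite /pvar.
rewrite (pdiff_split P1 P2 (borelI bA bQ) bB) (pdiff_split P1 P2 (borelD bA bQ) bB).
rewrite !(setIAC A Q B) !setDE !(setIAC _ (~` Q)) !(setIAC _ Q).
lra.
Qed.

Lemma pvar_ge0 A : borel A -> 0 <= w A.
Proof.
move=> bA; rewrite /pvar subr_ge0; apply: (@le_trans _ _ 0).
  by apply: Qneg; [exact: borelD|move=> x []].
by apply: Qpos; [exact: borelI|move=> x []].
Qed.

Lemma pvar_le A B : borel A -> borel B -> A `<=` B -> w A <= w B.
Proof.
move=> bA bB AB; rewrite (pvar_split bB bA) (_ : B `&` A = A); last exact/setIidPr.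
by rewrite lerDl pvar_ge0//; exact: borelD.
Qed.

Lemma pvar_geN A : borel A -> - v A <= w A /\ v A <= w A.
Proof.
move=> bA; rewrite /pvar (pdiff_split P1 P2 bA bQ).
have h1 : v (A `\` Q) <= 0 by apply: Qneg; [exact: borelD|move=> x []].
have h2 : 0 <= v (A `&` Q) by apply: Qpos; [exact: borelI|move=> x []].
by split; lra.
Qed.

Lemma pvar_le_rpr A : borel A -> w A <= rpr P1 A + rpr P2 A.
Proof.
move=> bA; rewrite /pvar /pdiff.
have := additive_on_split (rpr_additive P1) bA bQ.
have := additive_on_split (rpr_additive P2) bA bQ.
case: (rpr_additive P1) => _ [_ p1 _]; case: (rpr_additive P2) => _ [_ p2 _].
have := p1 _ (borelD bA bQ); have := p1 _ (borelI bA bQ).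
by have := p2 _ (borelD bA bQ); have := p2 _ (borelI bA bQ); lra.
Qed.

Lemma pvar_null A : borel A -> rpr P1 A = 0 -> rpr P2 A = 0 -> w A = 0.
Proof.
move=> bA A1 A2; apply/eqP; rewrite eq_le pvar_ge0// andbT.
by have := pvar_le_rpr bA; rewrite A1 A2 addr0.
Qed.

(** [pvar] is handled as a finitely additive function; it is dominated by [P1 + P2], whose tails
    over the union are small. *)
Lemma pvar_bigcup_null (A : nat -> set T) : (forall i, borel (A i)) ->
  (forall i, w (A i) = 0) -> w (\bigcup_i A i) = 0.
Proof.
move=> bA A0; have bU := borel_bigcup bA.
apply/eqP; rewrite eq_le pvar_ge0// andbT.
apply/ler_addgt0Pr => e e0; rewrite add0r.
have e2 : 0 < e / 2 by rewrite divr_gt0.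
have [N1 H1] := rpr_bigcup_tail P1 bA e2.
have [N2 H2] := rpr_bigcup_tail P2 bA e2.
pose F n := \big[setU/set0]_(i < n) A i.
have bF n : borel (F n) by exact: borel_bigsetU.
have F0 n : w (F n) = 0.
  elim: n => [|n IH]; first by rewrite /F big_ord0 pvar_null//; try exact: borel0; rewrite /rpr measure0.
  rewrite /F big_ord_recr/= -/(F n).
  apply/eqP; rewrite eq_le pvar_ge0 ?andbT; last exact: borelU.
  rewrite (pvar_split (borelU (bF n) (bA n)) (bF n)) -[leRHS]addr0 lerD//.
    rewrite -IH; apply: pvar_le => //.
    exact: borelI (borelU (bF n) (bA n)) (bF n).
  rewrite -(A0 n); apply: pvar_le => //; first exact: borelD (borelU (bF n) (bA n)) (bF n).
  by move=> x [[]].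
have mono n m : (n <= m)%N -> F n `<=` F m.
  by move=> nm; rewrite /F -!(bigcup_mkord _ A) => x [i /= im Ax]; exists i => //=; exact: leq_trans im nm.
pose N := maxn N1 N2.
rewrite (pvar_split bU (bF N)).
have -> : w (\bigcup_i A i `&` F N) = 0.
  apply/eqP; rewrite eq_le pvar_ge0 ?andbT; last exact: borelI.
  by rewrite -(F0 N); apply: pvar_le => //; exact: borelI.
rewrite add0r; apply: le_trans (pvar_le_rpr _) _; first exact: borelD.
rewrite [leRHS]splitr; apply: lerD.
  apply: le_trans H1; apply: (additive_on_le (rpr_additive P1)).
- exact: borelD.
- by apply: borelD => //; exact: bF.
- by move=> x [Ux Fx]; split => // F1x; apply: Fx; apply: (mono _ _ _ _ F1x); exact: leq_maxl.
apply: le_trans H2; apply: (additive_on_le (rpr_additive P2)).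
- exact: borelD.
- by apply: borelD => //; exact: bF.
- by move=> x [Ux Fx]; split => // F1x; apply: Fx; apply: (mono _ _ _ _ F1x); exact: leq_maxr.
Qed.

Hypothesis rT : radon_space R T.

(** As [pvar] is dominated by [P1 + P2], it suffices to unite compacts for [P1] and for [P2]. The
    sequence given to Lusin's theorem is constant, since only compactness is wanted. *)
Lemma sigma_compact_subset (E : set T) : borel E -> exists K : nat -> set T,
  [/\ forall n, compact (K n), forall n, K n `<=` E & w (E `\` \bigcup_n K n) = 0].
Proof.
move=> bE; case: (rT) => hT _ _.
have [K1 [c1 K1E n1 _]] := lusin_sigma_compact rT P1 bE (fun=> bE).
have [K2 [c2 K2E n2 _]] := lusin_sigma_compact rT P2 bE (fun=> bE).
pose K n := K1 n `|` K2 n.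
have cK n : compact (K n) by exact: compactU.
have bK n : borel (K n) by exact: borel_compact.
have bD : borel (E `\` \bigcup_n K n) by apply: borelD => //; exact: borel_bigcup.
exists K; split => //; first by move=> n x [/K1E|/K2E].
apply: pvar_null => //; apply/eqP; rewrite eq_le; apply/andP; split.
- rewrite -n1; apply: (additive_on_le (rpr_additive P1)) => //.
    by apply: borelD => //; apply: borel_bigcup => n; exact: borel_compact.
  by move=> x [Ex Kx]; split => // -[n _ ?]; apply: Kx; exists n => //; left.
- by case: (rpr_additive P1) => _ [_ + _]; apply.
- rewrite -n2; apply: (additive_on_le (rpr_additive P2)) => //.
    by apply: borelD => //; apply: borel_bigcup => n; exact: borel_compact.
  by move=> x [Ex Kx]; split => // -[n _ ?]; apply: Kx; exists n => //; right.
- by case: (rpr_additive P2) => _ [_ + _]; apply.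
Qed.

(* Injectivity of [p] on [G] makes the positive part of [G] the trace of some
   [p @^-1` D]; since [v] vanishes on the sets [p @^-1` F], the mass of [v] on [G] is
   compensated on [H] above the same points. *)
Lemma limb_le (C : ptopologicalType) (p : T -> C) (G H : set T) (F : set C) :
  hausdorff_space C -> continuous p -> borel G -> borel H ->
  rpr P1 (~` (G `|` H)) = 0 -> rpr P2 (~` (G `|` H)) = 0 ->
  G `&` H = set0 ->
  {in G &, injective p} ->
  (forall F, borel F -> v (p @^-1` F) = 0) -> borel F ->
  w (G `&` p @^-1` F) <= w (H `&` p @^-1` F).
Proof.
move=> hC cp bG bH z1 z2 GH injG vp bF.
have bp F' : borel F' -> borel (p @^-1` F') by exact: continuous_preimage_borel.
have vGH F' : borel F' -> v (G `&` p @^-1` F') = - v (H `&` p @^-1` F').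
  move=> bF'; have := vp _ bF'.
  rewrite (pdiff_split P1 P2 (bp _ bF') bG).
  rewrite (pdiff_split P1 P2 (borelD (bp _ bF') bG) bH).
  rewrite (pdiff_null (B := (p @^-1` F' `\` G) `\` H) _ _ _ z1 z2) ?addr0; last 3 first.
  - by apply: borelC; exact: borelU.
  - by apply: borelD => //; apply: borelD => //; exact: bp.
  - by move=> x [[_ Gx] Hx] [].
  rewrite setIC (_ : (p @^-1` F' `\` G) `&` H = H `&` p @^-1` F').
    by move=> /eqP; rewrite addr_eq0 => /eqP.
  apply/seteqP; split => x; first by move=> [[]].
  move=> [Hx Fx]; split => //; split => // Gx.
  by have : (G `&` H) x by []; rewrite GH.
(* The positive part of [G] is replaced by compacts because the image of a Borel set under [p] need
   not be Borel. *)
have [K [cK KG wK]] := sigma_compact_subset (borelI bG bQ).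
pose D := \bigcup_n p @` (K n).
have bD : borel D.
  apply: borel_bigcup => n; apply: borel_compact => //.
  by apply: continuous_compact => //; exact: continuous_subspaceT.
have DK : G `&` p @^-1` D = \bigcup_n K n.
  apply/seteqP; split => x; last first.
    by move=> [n _ Kx]; split; [case: (KG n x Kx)|exists n => //; exists x].
  move=> [Gx [n _ [y Ky pyx]]]; exists n => //.
  by rewrite -(injG _ _ _ _ pyx) ?inE//; case: (KG n y Ky).
have bGF : borel (G `&` p @^-1` F) by apply: borelI => //; exact: bp.
have bHF : borel (H `&` p @^-1` F) by apply: borelI => //; exact: bp.
have bK : borel (\bigcup_n K n).
  by apply: borel_bigcup => n; apply: borel_compact => //; case: (rT).
have bFD : borel (F `&` D) by exact: borelI.
have bFD' : borel (F `\` D) by exact: borelD.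
have vQ : v (G `&` p @^-1` F `&` Q) = v (G `&` p @^-1` (F `&` D)).
  rewrite (pdiff_split P1 P2 (borelI bGF bQ) bK).
  have -> : v ((G `&` p @^-1` F `&` Q) `\` \bigcup_n K n) = 0.
    have bX : borel ((G `&` p @^-1` F `&` Q) `\` \bigcup_n K n).
      by apply: borelD => //; exact: borelI.
    have : w ((G `&` p @^-1` F `&` Q) `\` \bigcup_n K n) <= 0.
      rewrite -wK; apply: pvar_le => //; first by apply: borelD => //; exact: borelI.
      by move=> x [[[Gx _] Qx] Kx].
    by have [] := pvar_geN bX; lra.
  rewrite addr0 preimage_setI setIA -DK; congr v.
  apply/seteqP; split => x; first by move=> [[[Gx Fx] Qx] [_ Dx]].
  move=> [[Gx Fx] Dx]; split => //; split => //.
  have : (\bigcup_n K n) x by rewrite -DK.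
  by move=> [n _ /KG[]].
have pD : p @^-1` (F `\` D) = p @^-1` F `\` p @^-1` D by [].
have vQ' : v (G `&` p @^-1` F `\` Q) = v (G `&` p @^-1` (F `\` D)).
  have := pdiff_split P1 P2 bGF bQ; rewrite vQ.
  rewrite (pdiff_split P1 P2 bGF (bp _ bD)).
  rewrite preimage_setI setIA pD setDE setIA -setDE.
  by lra.
have -> : w (G `&` p @^-1` F) = - v (H `&` p @^-1` (F `&` D)) + v (H `&` p @^-1` (F `\` D)).
  by rewrite /pvar vQ vQ' !vGH// opprK.
rewrite (pvar_split bHF (bp _ bD)).
have b1 : borel (H `&` p @^-1` (F `&` D)) by apply: borelI => //; exact: bp.
have b2 : borel (H `&` p @^-1` (F `\` D)) by apply: borelI => //; exact: bp.
have := pvar_geN b1; have := pvar_geN b2; rewrite preimage_setI pD.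
rewrite setDE !setIA -!setDE; lra.
Qed.

End variation.

(** * Equality of two measures carried by a graph and an antigraph *)

Section two_limbs.
Context {R : realType} {T A B : ptopologicalType}.
Hypothesis rT : radon_space R T.
Hypotheses (hA : hausdorff_space A) (hB : hausdorff_space B).
Variables (pa : T -> A) (pb : T -> B).
Hypotheses (ca : continuous pa) (cb : continuous pb).
Variables P1 P2 : probability (borelT T) R.
Hypothesis eqA : forall E, borel E -> P1 (pa @^-1` E) = P2 (pa @^-1` E).
Hypothesis eqB : forall E, borel E -> P1 (pb @^-1` E) = P2 (pb @^-1` E).
Variables (S : set T) (V : nat -> set B).
Hypotheses (bS : borel S) (S1 : rpr P1 (~` S) = 0) (S2 : rpr P2 (~` S) = 0).
Hypothesis bV : forall t, borel (V t).
Hypothesis chainV : forall s t, V s `<=` V t \/ V t `<=` V s.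
Let V' t := pb @^-1` V t.
Hypothesis anti : {in dominated pa V' S &, injective pb}.

(** The strict maxima [G] and the dominated points [H] have the same variation over each Borel set
    of either factor; comparison over the upper sets [V t] shows that [H] is null, and then so is
    [G]. *)
Lemma two_limbs E : borel E -> P1 E = P2 E.
Proof.
have bV' t : borel (V' t) by exact: continuous_preimage_borel.
have [S' [bS' S'S N1 N2 bH]] := borel_dominated rT hA ca P1 P2 bS bV'.
have [Q [bQ Qp Qn]] := pdiff_hahn P1 P2.
pose w := pvar P1 P2 Q; pose H := dominated pa V' S'; pose G := S' `\` H.
have HS' : H `<=` S' by move=> x [].
have bG : borel G by exact: borelD.
have GHU : G `|` H = S' by rewrite setUC setDUK.
have GH0 : G `&` H = set0 by rewrite setIC setDIK.
have HGU : H `|` G = S' by rewrite setUC.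
have HG0 : H `&` G = set0 by rewrite setIC.
have nS' (P : probability (borelT T) R) : rpr P (~` S) = 0 ->
    rpr P (S `\` S') = 0 -> rpr P (~` S') = 0.
  move=> h1 h2; apply/eqP; rewrite eq_le; apply/andP; split; last first.
    by case: (rpr_additive P) => _ [_ + _]; apply; exact: borelC.
  apply: (@le_trans _ _ (rpr P (~` S `|` (S `\` S')))).
    apply: (additive_on_le (rpr_additive P)); first exact: borelC.
      by apply: borelU; [exact: borelC|exact: borelD].
    by move=> x Sx'; have [Sx|Sx] := pselect (S x); [right|left].
  rewrite -[leRHS]addr0 -{1}h1 -h2.
  by apply: (additive_on_leU (rpr_additive P)); [exact: borelC|exact: borelD].
have z1 : rpr P1 (~` S') = 0 by exact: nS'.
have z2 : rpr P2 (~` S') = 0 by exact: nS'.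
have better x y : G x -> S' y -> pa y = pa x -> y <> x ->
    exists t, V' t x /\ ~ V' t y.
  move=> [Sx nHx] Sy pyx yx; apply: contrapT => /forallNP h; apply: nHx.
  split => //; exists y; split => // t Vx.
  by have /not_andP[//|/contrapT] := h t.
(* Two points of [G] in one fiber would each beat the other, which contradicts the nesting of the
   upper sets. *)
have injG : {in G &, injective pa}.
  move=> x y; rewrite !inE => Gx Gy pxy; apply: contrapT => xy.
  have [t [Vx Vy]] := better x y Gx Gy.1 (esym pxy) (fun e => xy (esym e)).
  have [s [Vy' Vx']] := better y x Gy Gx.1 pxy xy.
  by have [/(_ _ Vx)|/(_ _ Vy')] := chainV t s.
have injH : {in H &, injective pb}.
  have HS : H `<=` dominated pa V' S.
    by move=> x [/S'S Sx [y [/S'S Sy ? ? ?]]]; split => //; exists y.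
  move=> x y; rewrite !inE => Hx Hy; apply: anti; rewrite inE; exact: HS.
have va F : borel F -> pdiff P1 P2 (pa @^-1` F) = 0.
  by move=> bF; rewrite /pdiff /rpr eqA// subrr.
have vb F : borel F -> pdiff P1 P2 (pb @^-1` F) = 0.
  by move=> bF; rewrite /pdiff /rpr eqB// subrr.
have w0 X : borel X -> 0 <= w X by exact: pvar_ge0.
have wS X Y : borel X -> borel Y -> w X = w (X `&` Y) + w (X `\` Y).
  exact: pvar_split.
have wle X Y : borel X -> borel Y -> X `<=` Y -> w X <= w Y by exact: pvar_le.
have bpa F : borel F -> borel (pa @^-1` F) by exact: continuous_preimage_borel.
have bpb F : borel F -> borel (pb @^-1` F) by exact: continuous_preimage_borel.
have leA F : borel F -> w (G `&` pa @^-1` F) <= w (H `&` pa @^-1` F).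
  by apply: limb_le => //; rewrite GHU.
have leB F : borel F -> w (H `&` pb @^-1` F) <= w (G `&` pb @^-1` F).
  by apply: limb_le => //; rewrite ?HGU.
have wGH : w G <= w H.
  by have := leA _ borelT_set; rewrite preimage_setT !setIT.
have wHG : w H <= w G.
  by have := leB _ borelT_set; rewrite preimage_setT !setIT.
(* The inequality for [F] and for its complement, with equal totals, forces equality. *)
have eA F : borel F -> w (H `&` pa @^-1` F) = w (G `&` pa @^-1` F).
  move=> bF; have := leA _ bF; have := leA _ (borelC bF).
  rewrite preimage_setC -!setDE.
  have := wS _ _ bG (bpa _ bF); have := wS _ _ bH (bpa _ bF).
  by rewrite -!/w -!/H; lra.
have eB F : borel F -> w (H `&` pb @^-1` F) = w (G `&` pb @^-1` F).
  move=> bF; have := leB _ bF; have := leB _ (borelC bF).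
  rewrite preimage_setC -!setDE.
  have := wS _ _ bG (bpb _ bF); have := wS _ _ bH (bpb _ bF).
  by rewrite -!/w -!/H; lra.
have bGt t : borel (G `&` V' t) by exact: borelI.
have [K HK] := choice (fun t => sigma_compact_subset bQ Qp Qn rT (bGt t)).
have cK t n : compact (K t n) by case: (HK t).
have hT : hausdorff_space T by case: rT.
have bK t : borel (\bigcup_n K t n).
  by apply: borel_bigcup => n; exact: borel_compact.
pose N t := (G `&` V' t) `\` \bigcup_n K t n.
have bN t : borel (N t) by exact: borelD.
have wN t : w (N t) = 0 by case: (HK t).
have bNU : borel (\bigcup_t N t) by exact: borel_bigcup.
have wNU : w (\bigcup_t N t) = 0 by apply: pvar_bigcup_null.
(* The exceptional sets [N t] are removed from [G] once and for all: a point of [G] over [D'] that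
   lies in [V' t] then projects into [D t]. *)
have [L [cL LG wL]] := sigma_compact_subset bQ Qp Qn rT (borelD bG bNU).
have bL : borel (\bigcup_n L n) by apply: borel_bigcup => n; exact: borel_compact.
have bimg (M : nat -> set T) : (forall n, compact (M n)) ->
    borel (\bigcup_n pa @` (M n)).
  move=> cM; apply: borel_bigcup => n; apply: borel_compact => //.
  by apply: continuous_compact => //; exact: continuous_subspaceT.
pose D t := \bigcup_n pa @` (K t n); pose D' := \bigcup_n pa @` (L n).
have bD t : borel (D t) by exact: bimg.
have bD' : borel D' by exact: bimg.
have inD t y : G y -> V' t y -> ~ (\bigcup_t N t) y -> D t (pa y).
  move=> Gy Vy Ny; apply: contrapT => Dy; apply: Ny; exists t => //; split => //.
  by move=> [n _ Ky]; apply: Dy; exists n => //; exists y.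
have inD' x : D' (pa x) -> exists y, [/\ G y, pa y = pa x & ~ (\bigcup_t N t) y].
  by move=> [n _ [y /LG[Gy Ny] yx]]; exists y.
have le0 F : borel F -> w F <= 0 -> w F = 0.
  by move=> bF wF; apply/eqP; rewrite eq_le wF w0.
(* By [eA] the part of [H] off [D'] weighs as much as that of [G], which is null: almost every
   dominated point shares its fiber with a point of [G]. *)
have wHD' : w (H `\` pa @^-1` D') = 0.
  rewrite setDE preimage_setC eA; last exact: borelC.
  have bX : borel (G `&` pa @^-1` (~` D')) by apply: borelI => //; apply: bpa; exact: borelC.
  apply: le0 => //; rewrite (wS _ _ bX bNU) -[leRHS]addr0 lerD//.
    by rewrite -wNU; apply: wle => //; exact: borelI.
  rewrite -wL; apply: wle; first exact: borelD.
    by apply: borelD => //; exact: borelD.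
  move=> x [[Gx nDx] nNx]; split => // -[n _ Lx]; apply: nDx.
  by exists n => //; exists x.
have wGD t : w (G `&` pa @^-1` D t) = w (G `&` V' t).
  apply/eqP; rewrite eq_le; apply/andP; split.
    apply: wle => //; first by apply: borelI => //; exact: bpa.
    move=> x [Gx [n _ [y Ky yx]]]; have [_ /(_ n y Ky)[Gy Vy] _] := HK t.
    by rewrite -(injG y x)// inE.
  rewrite (wS _ _ (bGt t) (bK t)) -/(N t) wN addr0; apply: wle.
  - exact: borelI.
  - by apply: borelI => //; exact: bpa.
  - by move=> x [[Gx _] [n _ Kx]]; split => //; exists n => //; exists x.
(* [H] over [D t] weighs as much as [G] in [V' t] by [eA], hence as much as [H] in [V' t] by [eB];
   the latter lies almost entirely over [D t], so the excess is null. *)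
have step t : w ((H `&` pa @^-1` D t) `\` V' t) = 0.
  have bHD : borel (H `&` pa @^-1` D t) by apply: borelI => //; exact: bpa.
  have bHV : borel (H `&` V' t) by exact: borelI.
  have h1 := wS _ _ bHD (bV' t).
  have h2 := wS _ _ bHV (bpa _ (bD t)).
  (* If a dominated point lies in [V' t], so does the point of [G] in its fiber, the upper sets
     being nested. *)
  have h3 : w (H `&` V' t `\` pa @^-1` D t) = 0.
    apply: le0; first by apply: borelD => //; exact: bpa.
    rewrite -wHD'; apply: wle.
    - by apply: borelD => //; exact: bpa.
    - by apply: borelD => //; exact: bpa.
    move=> x [[Hx Vx] nDx]; split => // Dx; apply: nDx.
    have [y [Gy yx nNy]] := inD' x Dx.
    have xy : x <> y by move=> xy; have : (G `&` H) x; [split; rewrite // xy|rewrite GH0].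
    have [s [Vy Vx']] := better y x Gy (HS' _ Hx) (esym yx) xy.
    rewrite /= -yx; apply: inD => //.
    by have [/(_ _ Vx)//|] := chainV t s; apply.
  move: h1 h2; rewrite -/w eA// wGD eB// (setIAC H (V' t)).
  by move: h3; rewrite /w; lra.
(* Almost every point of [H] has a better point of [G] in its fiber, and some [V' s] contains only
   the better one; [step s] then applies. *)
have wH : w H = 0.
  apply: le0 => //.
  have bX := borelD bH (bpa _ bD').
  have bY t : borel ((H `&` pa @^-1` D t) `\` V' t).
    by apply: borelD => //; apply: borelI => //; exact: bpa.
  rewrite (wS _ _ bH (bpa _ bD')) -/w wHD' addr0.
  have <- : w (\bigcup_t ((H `&` pa @^-1` D t) `\` V' t)) = 0 by apply: pvar_bigcup_null.
  apply: wle; first by apply: borelI => //; exact: bpa.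
    exact: borel_bigcup.
  move=> x [Hx Dx].
  have [y [Gy yx nNy]] := inD' x Dx.
  have xy : x <> y by move=> xy; have : (G `&` H) x; [split; rewrite // xy|rewrite GH0].
  have [s [Vy Vx']] := better y x Gy (HS' _ Hx) (esym yx) xy.
  exists s => //; split => //; split => //=; rewrite -yx; exact: inD.
move=> bE; rewrite !rprE//; congr EFin.
have wE : w E = 0.
  apply: le0 => //; rewrite (wS _ _ bE bS').
  have h1 : w (E `&` S') <= 0.
    apply: (@le_trans _ _ (w S')); first by apply: wle => //; exact: borelI.
    rewrite (wS _ _ bS' bG) -/w.
    have -> : S' `&` G = G by apply/setIidPr => x [].
    have -> : S' `\` G = H by rewrite /G setDD; exact/setIidPr.
    by rewrite wH addr0; apply: le_trans wGH _; rewrite wH.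
  have h2 : w (E `\` S') <= w (~` S').
    by apply: wle; [exact: borelD|exact: borelC|move=> x []].
  have h3 : w (~` S') = 0 by apply: pvar_null => //; exact: borelC.
  by rewrite -/w; lra.
have [] := pvar_geN bQ Qp Qn bE; rewrite -/w wE /pdiff; lra.
Qed.

End two_limbs.

(** * Iterated products *)

Section iterated_product.
Context {R : realType} (X : nat -> completePseudoMetricType R).
Local Notation Z := (Zt X).

(** By proof irrelevance, the difference [d] and the equality used in the cast may be chosen
    freely. *)
Lemma restrE m n d (H : (m <= n)%N) (e : n = (d + m)%N) (x : Z n) :
  restr H x = restr_d (ecast k (Z k) e x).
Proof.
rewrite /restr; move: (esym (subnK H)).
have -> : (n - m)%N = d by rewrite e addnK.
by move=> e'; rewrite (eq_irrelevance e' e).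
Qed.

Lemma restr_id n (H : (n <= n)%N) (x : Z n) : restr H x = x.
Proof. by rewrite (restrE H (d := 0) (erefl _)). Qed.

Lemma restrS m n (H : (m <= n.+1)%N) (H' : (m <= n)%N) (x : Z n.+1) :
  restr H x = restr H' x.1.
Proof.
have e : n = (n - m + m)%N by rewrite subnK.
rewrite (restrE H' e) (restrE H (d := (n - m).+1) (congr1 S e)).
rewrite /=; congr restr_d.
have aux p (e' : n = p) (y : Z n.+1) :
  (ecast k (Z k) (congr1 S e') y).1 = ecast k (Z k) e' y.1 by case: _ / e'.
exact: aux.
Qed.

Lemma continuous_restr m n (H : (m <= n)%N) : continuous (restr H : Z n -> Z m).
Proof.
elim: n => [|n IH] in H *.
  have m0 : m = 0%N by apply/eqP; rewrite -leqn0.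
  subst m => x; rewrite (_ : restr H = id); first exact: cvg_id.
  by apply/funext => y; exact: restr_id.
have := H; rewrite leq_eqVlt => /predU1P[mn|mn].
  subst m => x; rewrite (_ : restr H = id); first exact: cvg_id.
  by apply/funext => y; exact: restr_id.
rewrite (_ : restr H = restr (mn : (m <= n)%N) \o fst); last first.
  by apply/funext => x; exact: restrS.
by move=> x; apply: continuous_comp; [exact: cvg_fst|exact: IH].
Qed.

Lemma restr_trans l m n (Hlm : (l <= m)%N) (Hmn : (m <= n)%N) (Hln : (l <= n)%N) (x : Z n) :
  restr Hlm (restr Hmn x) = restr Hln x.
Proof.
elim: n => [|n IH] in Hmn Hln x *.
  have m0 : m = 0%N by apply/eqP; rewrite -leqn0.
  by subst m; rewrite restr_id (eq_irrelevance Hlm Hln).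
have := Hmn; rewrite leq_eqVlt => /predU1P[mn|mn].
  by subst m; rewrite restr_id (eq_irrelevance Hlm Hln).
have mn' : (m <= n)%N by [].
rewrite (restrS Hmn mn') (restrS Hln (leq_trans Hlm mn')).
exact: IH.
Qed.

(** [coordZ] with a natural number as index and an explicit bound, which is easier to carry through
    inductions on [n]. *)
Definition cz n k (H : (k <= n)%N) (x : Z n) : X k := last_coord (restr H x).

Lemma coordZE n (k : 'I_n.+1) (x : Z n) (H : (k <= n)%N) : coordZ k x = cz H x.
Proof. by rewrite /coordZ (eq_irrelevance H (ltn_ord k)). Qed.

Lemma cz_last n (H : (n <= n)%N) (x : Z n) : cz H x = last_coord x.
Proof. by rewrite /cz restr_id. Qed.

Lemma cz_fst n k (H : (k <= n.+1)%N) (H' : (k <= n)%N) (x : Z n.+1) :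
  cz H x = cz H' x.1.
Proof. by rewrite /cz (restrS H H'). Qed.

Lemma continuous_last_coord n : continuous (@last_coord R X n).
Proof. by case: n => [|n] x; [exact: cvg_id|exact: cvg_snd]. Qed.

Lemma continuous_cz n k (H : (k <= n)%N) : continuous (cz H).
Proof.
move=> x; apply: (@continuous_comp _ _ _ (restr H) (@last_coord R X k)).
  exact: continuous_restr.
exact: continuous_last_coord.
Qed.

Fixpoint sumZ (psi : forall k, X k -> R) n : Z n -> R :=
  match n return Z n -> R with
  | 0 => fun x => psi 0%N x
  | n'.+1 => fun x => sumZ psi x.1 + psi n'.+1 x.2
  end.

Lemma sumZE (psi : forall k, X k -> R) n (x : Z n) :
  \sum_(k < n.+1) psi k (coordZ k x) = sumZ psi x.
Proof.
elim: n x => [|n IH] x.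
  by rewrite big_ord_recl big_ord0 addr0 (coordZE (k := ord0) x (leqnn 0)) cz_last.
rewrite big_ord_recr /= -IH; congr +%R.
  apply: eq_bigr => k _ /=.
  have Hk : (k <= n)%N by rewrite -ltnS.
  rewrite (coordZE (k := widen_ord (leqnSn n.+1) k) x (leqW Hk)).
  by rewrite (coordZE (k := k) x.1 Hk) (cz_fst _ Hk).
by rewrite (coordZE (k := ord_max) x (leqnn n.+1)) cz_last.
Qed.

Lemma sumZ_restr (psi : forall k, X k -> R) m n (H : (m <= n)%N) (x : Z n) :
  \sum_(k < n.+1 | (m < k)%N) psi k (coordZ k x) = sumZ psi x - sumZ psi (restr H x).
Proof.
elim: n => [|n IH] in H x *.
  have m0 : m = 0%N by apply/eqP; rewrite -leqn0.
  subst m; rewrite restr_id subrr big1// => k.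
  by rewrite ltnNge -ltnS ltn_ord.
have := H; rewrite leq_eqVlt => /predU1P[mn|mn].
  subst m; rewrite restr_id subrr big1// => k.
  by rewrite ltnNge -ltnS ltn_ord.
rewrite big_mkcond big_ord_recr/= -big_mkcond/= mn (restrS H mn).
rewrite (coordZE (k := ord_max) x (leqnn n.+1)) cz_last /=.
rewrite addrAC -(IH mn x.1); congr +%R.
apply: eq_bigr => k _ /=.
have Hk : (k <= n)%N by rewrite -ltnS.
rewrite (coordZE (k := widen_ord (leqnSn n.+1) k) x (leqW Hk)).
by rewrite (coordZE (k := k) x.1 Hk) (cz_fst _ Hk).
Qed.

Fixpoint boxZ (K : forall k, set (X k)) n : set (Z n) :=
  match n return set (Z n) with
  | 0 => K 0%N
  | n'.+1 => @boxZ K n' `*` K n'.+1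
  end.
Arguments boxZ K n : clear implicits.

Lemma compact_boxZ (K : forall k, set (X k)) n :
  (forall k, (k <= n)%N -> compact (K k)) -> compact (boxZ K n).
Proof.
elim: n => [|n IH] cK; first exact: cK.
apply: compact_setX; last exact: cK.
by apply: IH => k kn; apply: cK; exact: leqW.
Qed.

Lemma boxZP (K : forall k, set (X k)) n (x : Z n) :
  boxZ K n x <-> forall k (H : (k <= n)%N), K k (cz H x).
Proof.
elim: n x => [|n IH] x.
  split => [Kx k H|/(_ 0%N (leqnn 0))]; last by rewrite cz_last.
  have k0 : k = 0%N by apply/eqP; rewrite -leqn0.
  by subst k; rewrite cz_last.
split => [[/IH Kx Kn] k H|Kx].
  have := H; rewrite leq_eqVlt => /predU1P[kn|kn]; first by subst k; rewrite cz_last.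
  by rewrite (cz_fst H kn).
split; last by have := Kx n.+1 (leqnn _); rewrite cz_last.
by apply/IH => k H; rewrite -(cz_fst (leqW H)).
Qed.

Lemma radon_Zt n : (forall k, (k <= n)%N -> radon_space R (X k)) ->
  radon_space R (Z n).
Proof.
elim: n => [|n IH] rX; first exact: rX.
apply: radon_prod; last exact: rX.
by apply: IH => k kn; apply: rX; exact: leqW.
Qed.

(** A rectangle is the intersection of the preimages of its two sides; the first side is reached by
    induction, the second is a coordinate. *)
Lemma borel_cylinders n (G : set (set (Z n))) :
  (forall k, (k <= n)%N -> radon_space R (X k)) ->
  (forall k (H : (k <= n)%N) E, borel E -> G (cz H @^-1` E)) ->
  borel (T := Z n) `<=` <<s G >>.
Proof.
elim: n G => [|n IH] G rX GE.
  move=> E bE; apply: sub_sigma_algebra.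
  rewrite (_ : E = cz (leqnn 0) @^-1` E); first exact: GE.
  have -> : cz (leqnn 0) = id by apply/funext => x; exact: cz_last.
  by [].
have rXn k : (k <= n)%N -> radon_space R (X k) by move=> kn; apply: rX; exact: leqW.
have [_ bZ _] := radon_Zt rXn; have [_ bX _] := rX n.+1 (leqnn _).
apply: (subset_trans (borel_prod bZ bX)).
apply: smallest_sub; first exact: smallest_sigma_algebra.
move=> _ [E1 [E2 [b1 b2 ->]]].
apply: (@measurableI _ (g_sigma_algebraType G) (fst @^-1` E1) (snd @^-1` E2)).
  (* The sets whose preimage lies in the generated sigma-algebra form a sigma-algebra, so the
     induction hypothesis can be applied to them. *)
  pose G' := [set E : set (Z n) | <<s G >> (fst @^-1` E : set (Z n.+1))].
  have sG' : <<s G' >> `<=` G'.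
    apply: smallest_sub => //; split => [|E hE|F hF].
    + by rewrite /G' /= preimage_set0; exact: (@measurable0 _ (g_sigma_algebraType G)).
    + by rewrite setTD /G' /= -preimage_setC; exact: (@measurableC _ (g_sigma_algebraType G)).
    + by rewrite /G' /= preimage_bigcup; exact: (@bigcupT_measurable _ (g_sigma_algebraType G)).
  apply: sG'; apply: IH b1 => // k H E bE; apply: sub_sigma_algebra.
  have <- : cz (leqW H) @^-1` E = fst @^-1` (cz H @^-1` E).
    have -> : cz (leqW H) = cz H \o fst by apply/funext => x; exact: cz_fst.
    by [].
  exact: GE.
apply: sub_sigma_algebra.
rewrite (_ : _ @^-1` _ = cz (leqnn n.+1) @^-1` E2); first exact: GE.
have -> : cz (leqnn n.+1) = snd by apply/funext => x; exact: cz_last.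
by [].
Qed.

End iterated_product.

Arguments boxZ {R X} K n.

(** * Complementary slackness *)

Section sublinear.
Context {R : realType} {V : lmodType R}.
Variable D : set V.
Hypothesis D0 : D 0.
Hypothesis DD : forall x y, D x -> D y -> D (x + y).
Hypothesis DZ : forall a x, D x -> D (a *: x).

(** Relative to a subspace [D], later the bounded functions, where the infima are finite. The
    inequality for positive scalars gives equality when applied to the inverse scalar. *)
Definition sublinear_on (q : V -> R) :=
  (forall x y, D x -> D y -> q (x + y) <= q x + q y) /\
  (forall a x, 0 < a -> D x -> q (a *: x) <= a * q x).

Lemma sublinear_on0 q : sublinear_on q -> 0 <= q 0.
Proof.
by move=> [qD _]; have := qD _ _ D0 D0; rewrite addr0; lra.
Qed.

Lemma sublinear_onN q x : sublinear_on q -> D x -> - q (- x) <= q x.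
Proof.
move=> sq Dx; have := sublinear_on0 sq.
have DNx : D (- x) by rewrite -scaleN1r; exact: DZ.
by have := sq.1 _ _ Dx DNx; rewrite subrr; lra.
Qed.

(** The infimum over [t >= 0] of [q (x + t *: y) - t * q y] is sublinear and lies below [q]. A
    minimal [q] cannot be lowered, so the value at [t = 1] yields the reverse of subadditivity. *)
Lemma sublinear_on_shift q y : sublinear_on q -> D y ->
  exists q', [/\ sublinear_on q', forall x, D x -> q' x <= q x &
    forall x, D x -> q' x <= q (x + y) - q y].
Proof.
move=> sq Dy.
pose F x := [set q (x + t *: y) - t * q y | t in [set t : R | 0 <= t]].
have qZ t : 0 <= t -> t * q y <= q (t *: y).
  rewrite le_eqVlt => /predU1P[<-|t0]; first by rewrite mul0r scale0r sublinear_on0.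
  have := sq.2 t^-1 (t *: y); rewrite invr_gt0 scalerA mulVf ?gt_eqF// scale1r.
  move=> /(_ t0 (DZ _ Dy)); by rewrite -ler_pdivlMl.
have lF x : D x -> lbound (F x) (- q (- x)).
  move=> Dx _ [t /= t0 <-].
  have DNx : D (- x) by rewrite -scaleN1r; exact: DZ.
  have := sq.1 (- x) (x + t *: y) DNx (DD Dx (DZ t Dy)).
  rewrite addrA addNr add0r; have := qZ _ t0; lra.
have iF x : D x -> has_inf (F x).
  move=> Dx; split; last by exists (- q (- x)); exact: lF.
  by exists (q (x + 0 *: y) - 0 * q y), 0 => /=.
have infF x t : D x -> 0 <= t -> inf (F x) <= q (x + t *: y) - t * q y.
  by move=> Dx t0; apply: ge_inf; [case: (iF x Dx)|exists t].
exists (fun x => inf (F x)); split; last 2 first.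
- by move=> x Dx; have := infF x 0 Dx (lexx 0); rewrite scale0r addr0 mul0r subr0.
- by move=> x Dx; have := infF x 1 Dx ler01; rewrite scale1r mul1r.
split.
- move=> x x' Dx Dx'; apply/ler_addgt0Pr => e e0.
  have e2 : 0 < e / 2 by rewrite divr_gt0.
  have [_ [t /= t0 <-] ht] := inf_adherent e2 (iF _ Dx).
  have [_ [t' /= t0' <-] ht'] := inf_adherent e2 (iF _ Dx').
  have := infF _ _ (DD Dx Dx') (addr_ge0 t0 t0').
  have := sq.1 _ _ (DD Dx (DZ t Dy)) (DD Dx' (DZ t' Dy)).
  rewrite scalerDl addrACA; lra.
- move=> a x a0 Dx; rewrite -ler_pdivrMl//; apply: lb_le_inf.
    by case: (iF _ Dx).
  move=> _ [t /= t0 <-]; rewrite ler_pdivrMl//.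
  apply: (le_trans (infF (a *: x) (a * t) (DZ a Dx) _)).
    by rewrite mulr_ge0// ltW.
  by rewrite -scalerA -scalerDr mulrBr mulrA lerB// sq.2//; exact: DD (DZ _ _).
Qed.

(* Hahn-Banach: a minimal sublinear functional below [p] is additive. *)
Lemma additive_below_sublinear p : sublinear_on p ->
  exists l : V -> R, [/\ l 0 = 0, forall x y, D x -> D y -> l (x + y) = l x + l y &
    forall x, D x -> l x <= p x].
Proof.
move=> sp.
pose S := {q : V -> R | sublinear_on q /\ forall x, D x -> q x <= p x}.
have Sp : sublinear_on p /\ forall x, D x -> p x <= p x by [].
(* The order is reversed, so that a maximal element in Zorn's lemma is a minimal functional. *)
pose le (q1 q2 : S) : bool := `[< forall x, D x -> proj1_sig q2 x <= proj1_sig q1 x >].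
have [|r s t /asboolP rs /asboolP st|A tA|q qmin] := @ZL_preorder S (exist _ p Sp) le.
- by move=> t; apply/asboolP.
- by apply/asboolP => x Dx; exact: le_trans (st x Dx) (rs x Dx).
- have [A0|/set0P[q0 Aq0]] := eqVneq A set0.
    by exists (exist _ p Sp) => s; rewrite A0.
  pose F x := [set proj1_sig q x | q in A].
  have iF x : D x -> has_inf (F x).
    move=> Dx; split; first by exists (proj1_sig q0 x), q0.
    exists (- p (- x)) => _ [q Aq <-]; have [sq qp] := proj2_sig q.
    have DNx : D (- x) by rewrite -scaleN1r; exact: DZ.
    by apply: le_trans (sublinear_onN sq Dx); rewrite lerN2 qp.
  have infF x q : D x -> A q -> inf (F x) <= proj1_sig q x.
    by move=> Dx Aq; apply: ge_inf; [case: (iF x Dx)|exists q].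
  have Si : sublinear_on (fun x => inf (F x)) /\ forall x, D x -> inf (F x) <= p x.
    split; last first.
      move=> x Dx; apply: le_trans (infF _ _ Dx Aq0) _.
      by have [_] := proj2_sig q0; apply.
    split.
      move=> x y Dx Dy; apply/ler_addgt0Pr => e e0.
      have e2 : 0 < e / 2 by rewrite divr_gt0.
      have [_ [q Aq <-] hq] := inf_adherent e2 (iF _ Dx).
      have [_ [q' Aq' <-] hq'] := inf_adherent e2 (iF _ Dy).
      (* Two members of a chain are comparable, so the smaller one serves both [x] and [y]. *)
      have [q'' [Aq'' q1 q2]] : exists q'' : S, [/\ A q'', proj1_sig q'' x <= proj1_sig q x &
          proj1_sig q'' y <= proj1_sig q' y].
        have [/asboolP h|/asboolP h] := tA _ _ Aq Aq'.
          by exists q'; split => //; exact: h.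
        by exists q; split => //; exact: h.
      have [[qD _] _] := proj2_sig q''.
      have := infF _ _ (DD Dx Dy) Aq''; have := qD _ _ Dx Dy; lra.
    move=> a x a0 Dx; rewrite -ler_pdivrMl//; apply: lb_le_inf.
      by case: (iF _ Dx).
    move=> _ [q Aq <-]; rewrite ler_pdivrMl//.
    apply: le_trans (infF _ _ (DZ a Dx) Aq) _.
    by have [[_ qZ] _] := proj2_sig q; exact: qZ.
  by exists (exist _ (fun x => inf (F x)) Si) => q Aq; apply/asboolP => x Dx /=; exact: infF.
have [sq qp] := proj2_sig q.
have qD x y : D x -> D y -> proj1_sig q (x + y) = proj1_sig q x + proj1_sig q y.
  move=> Dx Dy; apply/eqP; rewrite eq_le sq.1//=.
  have [q' [sq' q'q q'y]] := sublinear_on_shift sq Dy.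
  have Sq' : sublinear_on q' /\ forall x, D x -> q' x <= p x.
    by split => // z Dz; exact: le_trans (q'q z Dz) (qp z Dz).
  have /asboolP/(_ x Dx) /= h : le (exist _ q' Sq') q.
    by apply: qmin; apply/asboolP.
  by rewrite -lerBrDr; exact: le_trans h (q'y x Dx).
exists (proj1_sig q); split => //.
by have := qD _ _ D0 D0; rewrite addr0; lra.
Qed.

End sublinear.

(** * The finitely additive plan obtained from dual optimality *)

Section dual_content.
Context {R : realType} (X : nat -> completePseudoMetricType R) (n : nat).
Variable mu : forall k : nat, probability (borelT (X k)) R.
Local Notation Z := (Zt X n).

Definition marginal_sum (psi : forall k, X k -> R) : R :=
  \sum_(k < n.+1) (\int[mu k]_x psi k x)%R.
Local Notation J := marginal_sum.

Definition all_L1 (psi : forall k, X k -> R) := forall k, (k <= n)%N -> L1 mu (psi k).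

Lemma all_L1D (f g : forall k, X k -> R) : all_L1 f -> all_L1 g ->
  all_L1 (fun k x => f k x + g k x) /\
  J (fun k x => f k x + g k x) = J f + J g.
Proof.
move=> Lf Lg; split.
  move=> k kn; have := integrableD measurableT (Lf k kn) (Lg k kn).
  by apply: eq_integrable.
rewrite /J -big_split; apply: eq_bigr => k _ /=.
have kn : (k <= n)%N by rewrite -ltnS.
by rewrite RintegralD//; [exact: Lf|exact: Lg].
Qed.

Lemma all_L1Z (f : forall k, X k -> R) (a : R) : all_L1 f ->
  all_L1 (fun k x => a * f k x) /\ J (fun k x => a * f k x) = a * J f.
Proof.
move=> Lf; split.
  move=> k kn; have := integrableZl measurableT a (Lf k kn).
  by apply: eq_integrable.
rewrite /J mulr_sumr; apply: eq_bigr => k _ /=.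
have kn : (k <= n)%N by rewrite -ltnS.
by rewrite RintegralZl//; exact: Lf.
Qed.

(** The family with [f] at index [k] and 0 elsewhere; the cast is there because the type of [f]
    depends on the index. *)
Definition single k (f : X k -> R) j : X j -> R :=
  match pselect (k = j) with
  | left e => fun x => f (ecast i (X i) (esym e) x)
  | right _ => fun=> 0
  end.

Lemma single_id k (f : X k -> R) : single f (j := k) = f.
Proof.
rewrite /single; case: pselect => // e; apply/funext => x.
by rewrite (eq_irrelevance e erefl).
Qed.

Lemma single_neq k j (f : X k -> R) : k <> j -> single f (j := j) = fun=> 0.
Proof. by rewrite /single; case: pselect. Qed.

Lemma sumZ_single k m (H : (k <= m)%N) (f : X k -> R) (x : Zt X m) :
  sumZ (single f) x = f (cz H x).
Proof.
pose o := Ordinal (H : (k < m.+1)%N).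
rewrite -sumZE (bigD1 o)//= single_id (coordZE (k := o) x H) big1 ?addr0//.
move=> i ik; rewrite single_neq// => ki; move/eqP: ik; apply.
exact: val_inj.
Qed.

Lemma L1_cst k (a : R) : L1 mu (fun _ : X k => a) /\ (\int[mu k]_x a)%R = a.
Proof.
split; first exact: finite_measure_integrable_cst.
by rewrite Rintegral_cst//= probability_setT mulr1.
Qed.

Lemma all_L1_single k (f : X k -> R) : (k <= n)%N -> L1 mu f ->
  all_L1 (single f) /\ J (single f) = (\int[mu k]_x f x)%R.
Proof.
move=> H Lf; split.
  move=> j jn; have [kj|kj] := pselect (k = j).
    by subst j; rewrite single_id.
  by rewrite single_neq//; exact: integrable0.
rewrite /J (bigD1 (Ordinal (H : (k < n.+1)%N)))//= single_id big1 ?addr0//.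
move=> i ik; rewrite single_neq; first exact: (L1_cst _ 0).2.
by move=> ki; move/eqP: ik; apply; exact: val_inj.
Qed.

Lemma L1_indic k (E : set (X k)) : borel E ->
  L1 mu (\1_E : X k -> R) /\ (\int[mu k]_x (\1_E x : R))%R = fine (mu k E).
Proof.
move=> bE; split.
  exact: (@integrable_indic _ (borelT (X k))).
by rewrite /Rintegral integral_indic// setIT.
Qed.

Variable r : Z -> R.
Hypothesis r0 : forall x, 0 <= r x.
(** This is how dual optimality enters: it says that the functional [p] below is nonnegative at
    0. *)
Hypothesis dual0 : forall psi s, all_L1 psi -> 0 <= s ->
  (forall x, 0 <= sumZ psi x + s * r x) -> 0 <= J psi.

Lemma sumZD (f g : forall k, X k -> R) m (x : Zt X m) :
  sumZ (fun k x => f k x + g k x) x = sumZ f x + sumZ g x.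
Proof. by elim: m x => [|m IH] x //=; rewrite IH addrACA. Qed.

Lemma sumZZ (f : forall k, X k -> R) a m (x : Zt X m) :
  sumZ (fun k x => a * f k x) x = a * sumZ f x.
Proof. by elim: m x => [|m IH] x //=; rewrite IH mulrDr. Qed.

(** [R^o] turns the functions on [Z] into a module over [R]. Below, [p f] is the infimum of the dual
    values of separable majorants of [f], up to nonnegative multiples of [r]. *)
Let bounded (f : Z -> R^o) := exists M : R, forall x, `|f x| <= M.

Let above (f : Z -> R^o) := [set J psi | psi in [set psi | all_L1 psi /\
  exists s, 0 <= s /\ forall x, f x <= sumZ psi x + s * r x]].

Let p (f : Z -> R^o) := inf (above f).

Let const0 (M : R) := single (fun _ : X 0 => M).

Let const0_L1 M : all_L1 (const0 M) /\ J (const0 M) = M.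
Proof.
have [h1 h2] := L1_cst 0 M.
by have [h3] := @all_L1_single 0 (fun=> M) (leq0n n) h1; rewrite h2.
Qed.

Let sumZ_const0 M (x : Z) : sumZ (const0 M) x = M.
Proof. by rewrite (sumZ_single (leq0n n)). Qed.

Let above_lb f : bounded f -> has_inf (above f).
Proof.
move=> [M fM]; split.
  have [h1 h2] := const0_L1 M.
  exists M, (const0 M) => //; split => //; exists 0; split => // x.
  by rewrite sumZ_const0 mul0r addr0; exact: le_trans (ler_norm _) (fM x).
exists (- M) => _ [psi [Lpsi [s [s0 hs]]] <-].
have [h1 h2] := const0_L1 M.
have [h3 h4] := all_L1D h1 Lpsi.
have : 0 <= J (fun k x => const0 M x + psi k x).
  apply: (dual0 h3 s0) => x; rewrite sumZD sumZ_const0 -addrA.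
  have := hs x; have := fM x; rewrite ler_norml => /andP[]; lra.
by rewrite h4 h2; lra.
Qed.

Let p_le f psi s : bounded f -> all_L1 psi -> 0 <= s ->
  (forall x, f x <= sumZ psi x + s * r x) -> p f <= J psi.
Proof.
move=> bf Lpsi s0 hs; apply: ge_inf; first by case: (above_lb bf).
by exists psi => //; split => //; exists s.
Qed.

Let b0 : bounded 0. Proof. by exists 0 => x; rewrite normr0. Qed.

Let bD f g : bounded f -> bounded g -> bounded (f + g).
Proof.
move=> [M fM] [M' gM]; exists (M + M') => x.
by apply: le_trans (ler_normD _ _) (lerD (fM x) (gM x)).
Qed.

Let bZ a f : bounded f -> bounded (a *: f).
Proof.
move=> [M fM]; exists (`|a| * M) => x.
by rewrite [X in `|X|](_ : _ = a * f x)// normrM ler_wpM2l.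
Qed.

Let p_sublinear : sublinear_on bounded p.
Proof.
split.
  move=> f g bf bg; apply/ler_addgt0Pr => e e0.
  have e2 : 0 < e / 2 by rewrite divr_gt0.
  have [_ [psi [L1psi [s [s0 hs]]] <-] h1] := inf_adherent e2 (above_lb bf).
  have [_ [psi' [L1psi' [s' [s0' hs']]] <-] h2] := inf_adherent e2 (above_lb bg).
  have [h3 h4] := all_L1D L1psi L1psi'.
  have : p (f + g) <= J (fun k x => psi k x + psi' k x).
    apply: (p_le (bD bf bg) h3 (addr_ge0 s0 s0')) => x.
    rewrite sumZD mulrDl [leLHS](_ : _ = f x + g x)//.
    by have := hs x; have := hs' x; lra.
  by rewrite h4; move: h1 h2; rewrite -!/(p _); lra.
move=> a f a0 bf; rewrite -ler_pdivrMl//; apply: lb_le_inf.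
  by case: (above_lb bf).
move=> _ [psi [L1psi [s [s0 hs]]] <-]; rewrite ler_pdivrMl//.
have [h3 <-] := all_L1Z a L1psi.
apply: (p_le (bZ a bf) h3 (s := a * s)) => [|x]; first by rewrite mulr_ge0// ltW.
by rewrite sumZZ -mulrA -mulrDr [leLHS](_ : _ = a * f x)// ler_wpM2l// ltW.
Qed.

(** An additive [l] below [p] is evaluated at indicators. Positivity, marginals and null sets each
    come from a separable majorant of an indicator or of its opposite. *)
Lemma dual_content : exists m : set Z -> R, [/\ additive_on setT m, m setT = 1,
  forall k (H : (k <= n)%N) E, borel E -> m (cz H @^-1` E) = fine (mu k E) &
  forall (A : set Z) t, 0 < t -> (forall x, A x -> t <= r x) -> m A = 0].
Proof.
have [l [l0 lD lp]] := additive_below_sublinear b0 bD bZ p_sublinear.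
have bI (A : set Z) : bounded (\1_A : Z -> R^o).
  by exists 1 => x; rewrite indicE; case: (_ \in _); rewrite ?normr1 ?normr0.
have bN f : bounded f -> bounded (- f) by rewrite -scaleN1r; exact: bZ.
have lN f : bounded f -> l (- f) = - l f.
  by move=> bf; have := lD _ _ bf (bN _ bf); rewrite subrr l0; lra.
have ge0 (A : set Z) : 0 <= l (\1_A : Z -> R^o).
  have L0 : all_L1 (fun k _ => 0) by move=> k _; exact: (L1_cst k 0).1.
  have J0 : J (fun k _ => 0) = 0 by rewrite /J big1// => k _; exact: (L1_cst _ 0).2.
  have := lp _ (bN _ (bI A)); rewrite lN// => h.
  have := p_le (bN _ (bI A)) L0 (lexx 0); rewrite J0 => /(_ _)/(le_trans h).
  rewrite oppr_le0; apply => x; rewrite mul0r addr0.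
  have -> : sumZ (fun k (_ : X k) => 0) x = 0.
    by elim: (n) x => [|m IH] x //=; rewrite IH addr0.
  by rewrite [leLHS](_ : _ = - (\1_A x : R))// oppr_le0 indicE.
have cyl k (H : (k <= n)%N) (E : set (X k)) : borel E ->
    l (\1_(cz H @^-1` E) : Z -> R^o) <= fine (mu k E).
  move=> bE; have [h1 <-] := L1_indic bE; have [h2 <-] := all_L1_single H h1.
  apply: le_trans (lp _ (bI _)) _; apply: (p_le (bI _) h2 (lexx 0)) => x.
  by rewrite (sumZ_single H) mul0r addr0 !indicE.
have add (A B : set Z) : A `&` B = set0 ->
    l (\1_(A `|` B) : Z -> R^o) = l (\1_A : Z -> R^o) + l (\1_B : Z -> R^o).
  move=> AB; rewrite -lD//; congr l; apply/funext => x.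
  rewrite [RHS](_ : _ = (\1_A x : R) + \1_B x)// !indicE in_setU.
  have [xA|xA] := boolP (x \in A); have [xB|xB] := boolP (x \in B); rewrite /= ?addr0 ?add0r//.
  by have : (A `&` B) x; [split; exact: set_mem|rewrite AB].
have l1 : l (\1_setT : Z -> R^o) = 1.
  apply/eqP; rewrite eq_le; apply/andP; split.
    have := cyl 0%N (leq0n n) setT borelT_set.
    by rewrite preimage_setT probability_setT.
  have [h1 h2] := const0_L1 (-1).
  have := lp _ (bN _ (bI setT)); rewrite lN// => h.
  have := p_le (bN _ (bI setT)) h1 (lexx 0); rewrite h2 => /(_ _)/(le_trans h).
  rewrite lerN2; apply => x; rewrite sumZ_const0 mul0r addr0.
  by rewrite [leLHS](_ : _ = - (\1_setT x : R))// indicE in_setT.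
exists (fun A => l (\1_A : Z -> R^o)); split => //.
- split; first by [].
  split => //; last by move=> A B _ _; exact: add.
  by rewrite -[RHS]l0; congr l; apply/funext => x; rewrite indicE in_set0.
(* The upper bounds for [E] and for its complement add up to 1, the total mass, hence both are
   equalities. *)
- move=> k H E bE; apply/eqP; rewrite eq_le cyl//=.
  have := cyl k H _ (borelC bE).
  have := add (cz H @^-1` E) (cz H @^-1` (~` E)).
  rewrite -preimage_setC setUv setICr l1 => /(_ erefl).
  rewrite probability_setC// fineB//; last by rewrite fin_num_measure.
  rewrite /=; lra.
(* Here [t^-1 * r] majorizes the indicator of [A], with zero separable part. *)
- move=> A t t0 At; apply/eqP; rewrite eq_le ge0 andbT.
  have L0 : all_L1 (fun k _ => 0) by move=> k _; exact: (L1_cst k 0).1.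
  have J0 : J (fun k _ => 0) = 0 by rewrite /J big1// => k _; exact: (L1_cst _ 0).2.
  apply: le_trans (lp _ (bI _)) _; rewrite -J0.
  have t10 : 0 <= t^-1 by rewrite invr_ge0 ltW.
  apply: (p_le (bI _) L0 t10) => x.
  have -> : sumZ (fun k (_ : X k) => 0) x = 0.
    by elim: (n) x => [|m IH] x //=; rewrite IH addr0.
  rewrite add0r indicE; have [/set_mem Ax|_] := boolP (x \in A); last by rewrite mulr_ge0.
  by rewrite /= ler_pdivlMl// mulr1 At.
Qed.

End dual_content.

(** * From the finitely additive plan to a coupling *)

Section dual_plan.
Context {R : realType} (X : nat -> completePseudoMetricType R) (n : nat).
Variable mu : forall k : nat, probability (borelT (X k)) R.
Local Notation Z := (Zt X n).
Hypothesis rX : forall k, (k <= n)%N -> radon_space R (X k).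
Variable m : set Z -> R.
Hypothesis mD : additive_on setT m.
Hypothesis m1 : m setT = 1.
Hypothesis mcyl : forall k (H : (k <= n)%N) E, borel E ->
  m (cz H @^-1` E) = fine (mu k E).

Let hZ : hausdorff_space Z.
Proof. by case: (radon_Zt rX). Qed.

Let le_m (A B : set Z) : A `<=` B -> m A <= m B.
Proof. exact: (additive_on_le mD). Qed.

(** Each marginal is tight: a box of compacts loses at most [e / (n + 1)] per coordinate, and finite
    subadditivity suffices. *)
Lemma coupling_inner_compact : inner_compact m setT.
Proof.
move=> e e0.
have e1 : 0 < e / n.+1%:R by rewrite divr_gt0.
(* The bound on [k] is put under the existential so that [K] can be chosen for all [k]; [set0] is a
   dummy value. *)
have h k : exists K : set (X k), (k <= n)%N ->
    [/\ compact K, borel K & rpr (mu k) (~` K) <= e / n.+1%:R].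
  have [kn|kn] := boolP (k <= n)%N; last by exists set0.
  have [hk _ /(_ (mu k) _ borelT_set _ e1)[K [cK _ mK]]] := rX kn.
  exists K => _; split => //; first exact: borel_compact.
  by rewrite -setTD.
pose K k := sval (cid (h k)).
have HK k := svalP (cid (h k)); rewrite -/(K _) in HK.
exists (boxZ K n); split => //.
  by apply: compact_boxZ => k kn; case: (HK k kn).
pose A k := [set x : Z | exists H : (k <= n)%N, ~ K k (cz H x)].
apply: (@le_trans _ _ (m (\big[setU/set0]_(i < n.+1) A i))).
  apply: le_m => x [_ /boxZP/existsNP[k /existsNP[H Kx]]].
  rewrite -(bigcup_mkord n.+1 A); exists k => //=.
  by exists H.
have [_ h1] := additive_on_bigU mD n.+1 (A := A) (fun=> I).
apply: (le_trans h1).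
apply: (@le_trans _ _ (\sum_(i < n.+1) e / n.+1%:R)); last first.
  by rewrite sumr_const card_ord -[leLHS]mulr_natr divfK// pnatr_eq0.
apply: ler_sum => i _; have H : (i <= n)%N by rewrite -ltnS.
have [_ bK mK] := HK i H; apply: le_trans mK.
rewrite /rpr -(mcyl H); last exact: borelC.
by apply: le_m => x [H' /=]; rewrite (eq_irrelevance H' H).
Qed.

(** A cylinder over a compact is closed; intersecting it with a compact of nearly full mass makes it
    compact. *)
Lemma coupling_tight_cylinder k (H : (k <= n)%N) E : borel E ->
  tight_set setT m (cz H @^-1` E).
Proof.
have [hk _ rk] := rX H.
have inner F : borel F -> inner_compact m (cz H @^-1` F).
  move=> bF e e0; have e2 : 0 < e / 2 by rewrite divr_gt0.
  have [C [cC _ mC]] := coupling_inner_compact e2.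
  have [K [cK KF mK]] := rk (mu k) _ bF _ e2.
  have bK := borel_compact hk cK.
  exists (C `&` cz H @^-1` K); split.
  - apply: (subclosed_compact _ cC) => //; apply: closedI; first exact: compact_closed.
    apply: preimage_closed; first by move=> x _; exact: continuous_cz.
    exact: compact_closed.
  - by move=> x [_ /KF].
  apply: (@le_trans _ _ (m (~` C `|` cz H @^-1` (F `\` K)))).
    by apply: le_m => x [Fx /not_andP[Cx|Kx]]; [left|right].
  apply: le_trans (additive_on_leU mD _ _) _ => //.
  by rewrite [leRHS]splitr lerD -?setTD// mcyl//; exact: borelD.
move=> bE; split => //; first exact: inner.
by rewrite preimage_setC; apply: inner; exact: borelC.
Qed.

Lemma coupling_tight_box (K : forall k, set (X k)) : (forall k, (k <= n)%N -> borel (K k)) ->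
  tight_set setT m (boxZ K n).
Proof.
move=> bK.
have cD : forall C : set Z, compact C -> [set: set Z] C by [].
have tI (A B : set Z) : tight_set setT m A -> tight_set setT m B -> tight_set setT m (A `&` B).
  move=> tA tB; rewrite -[A]setCK -[B]setCK -setCU; apply: (tight_setC mD).
  by apply: (tight_setU mD hZ cD); exact: (tight_setC mD).
have step j : (j <= n)%N ->
    tight_set setT m [set x | forall k (H : (k <= n)%N), (k <= j)%N -> K k (cz H x)].
  elim: j => [|j IH] jn.
    rewrite (_ : [set x | _] = cz (leq0n n) @^-1` K 0%N).
      by apply: coupling_tight_cylinder; exact: bK.
    apply/seteqP; split => x /=; first exact.
    move=> Kx k H k0; have k0' : k = 0%N by apply/eqP; rewrite -leqn0.
    by subst k; rewrite (eq_irrelevance H (leq0n n)).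
  rewrite (_ : [set x | _] =
      [set x | forall k (H : (k <= n)%N), (k <= j)%N -> K k (cz H x)] `&` cz jn @^-1` K j.+1).
    by apply: tI; [apply: IH; exact: ltnW|apply: coupling_tight_cylinder; exact: bK].
  apply/seteqP; split => x /=.
    by move=> Kx; split; [move=> k H kj; apply: Kx; exact: leqW|exact: Kx].
  move=> [Kx Kj] k H; rewrite leq_eqVlt => /predU1P[kj|kj]; last exact: Kx.
  by subst k; rewrite (eq_irrelevance H jn).
rewrite (_ : boxZ K n = [set x | forall k (H : (k <= n)%N), (k <= n)%N -> K k (cz H x)]).
  exact: step.
apply/seteqP; split => x; first by move=> /boxZP Kx k H _; exact: Kx.
by move=> Kx; apply/boxZP => k H; exact: Kx.
Qed.

Lemma borel_box (K : forall k, set (X k)) j : (j <= n)%N ->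
  (forall k, (k <= n)%N -> borel (K k)) ->
  borel (boxZ K j).
Proof.
move=> + bK; elim: j => [|j IH] jn; first exact: bK.
apply: (borelI (A := fst @^-1` boxZ K j) (B := snd @^-1` K j.+1)).
  apply: continuous_preimage_borel; first by move=> x; exact: cvg_fst.
  by apply: IH; exact: ltnW.
apply: continuous_preimage_borel; first by move=> x; exact: cvg_snd.
exact: bK.
Qed.

Lemma coupling_of_content : exists P : probability (borelT Z) R,
  (forall k (H : (k <= n)%N) E, borel E -> P (cz H @^-1` E) = mu k E) /\
  forall K : forall k, set (X k), (forall k, (k <= n)%N -> borel (K k)) ->
    P (boxZ K n) = (m (boxZ K n))%:E.
Proof.
have [|P HP] := tight_extension mD hZ m1 coupling_inner_compact.
  apply: borel_cylinders => // k H E bE; exact: coupling_tight_cylinder.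
exists P; split.
  move=> k H E bE; rewrite HP; last exact: coupling_tight_cylinder.
    by rewrite mcyl// fineK// fin_num_measure.
  by apply: continuous_preimage_borel => //; exact: continuous_cz.
move=> K bK; rewrite HP//; last exact: coupling_tight_box.
exact: borel_box.
Qed.

End dual_plan.

(** * Countable families of boxes and rational bounds *)

Section box_base.
Context {R : realType} (X : nat -> completePseudoMetricType R).

Lemma eq_boxZ (K K' : forall k, set (X k)) n :
  (forall k, (k <= n)%N -> K k = K' k) -> boxZ K n = boxZ K' n.
Proof.
elim: n => [|n IH] KK' /=; first exact: KK'.
by rewrite IH ?KK'// => k kn; apply: KK'; exact: leqW.
Qed.

(** Basic boxes are coded by finite sequences of indices, a countable type, so that they can be
    enumerated. *)
Lemma box_base (U : forall k, nat -> set (X k)) n :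
  (forall k, (k <= n)%N -> forall x V, nbhs x V -> exists i, U k i x /\ U k i `<=` V) ->
  forall (x : Zt X n) V, nbhs x V ->
  exists s : seq nat, [/\ size s = n.+1,
    boxZ (fun k => U k (nth 0%N s k)) n x & boxZ (fun k => U k (nth 0%N s k)) n `<=` V].
Proof.
elim: n => [|n IH] bU x V nV.
  by have [i [Ux UV]] := bU 0%N isT x V nV; exists [:: i].
case: nV => -[V1 V2] /= [nV1 nV2] VV.
have [||s [ss sx sV]] := IH _ x.1 V1 => //; first by move=> k kn; apply: bU; exact: leqW.
have [i [Ux UV]] := bU n.+1 (leqnn _) x.2 V2 nV2.
have e : boxZ (fun k => U k (nth 0%N (rcons s i) k)) n = boxZ (fun k => U k (nth 0%N s k)) n.
  by apply: eq_boxZ => k kn; rewrite nth_rcons ss ltnS kn.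
have e' : nth 0%N (rcons s i) n.+1 = i by rewrite nth_rcons ss ltnn eqxx.
exists (rcons s i); split; first by rewrite size_rcons ss.
  by split; [rewrite e|rewrite e'].
move=> y [/=]; rewrite e e' => y1 y2; apply: VV; split; [exact: sV|exact: UV].
Qed.

(** The allowance [e] is halved between the last coordinate and the earlier ones; rational bounds
    keep the family of boxes countable. *)
Lemma sumZ_rat_approx (phi : forall k, X k -> R) n (x : Zt X n) e : 0 < e ->
  exists q : seq rat, [/\ size q = n.+1,
    forall k (H : (k <= n)%N), phi k (cz H x) < ratr (nth 0 q k) &
    sumZ (fun k (_ : X k) => ratr (nth 0 q k)) x < sumZ phi x + e].
Proof.
elim: n x e => [|n IH] x e e0.
  have [|q] := @rat_in_itvoo R (phi 0%N x) (phi 0%N x + e) _.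
    by rewrite ltrDl.
  rewrite in_itv/= => /andP[q1 q2]; exists [:: q]; split => //.
  move=> k H; have k0 : k = 0%N by apply/eqP; rewrite -leqn0.
  by subst k; rewrite cz_last.
have e2 : 0 < e / 2 by rewrite divr_gt0.
have [s [ss s1 s2]] := IH x.1 _ e2.
have [|q] := @rat_in_itvoo R (phi n.+1 x.2) (phi n.+1 x.2 + e / 2) _.
  by rewrite ltrDl.
rewrite in_itv/= => /andP[q1 q2].
have e' : nth 0 (rcons s q) n.+1 = q by rewrite nth_rcons ss ltnn eqxx.
exists (rcons s q); split; first by rewrite size_rcons ss.
  move=> k H; have := H; rewrite leq_eqVlt => /predU1P[kn|kn].
    by subst k; rewrite cz_last e'.
  by rewrite (cz_fst H kn) nth_rcons ss kn s1.
rewrite /= e'.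
have -> : sumZ (fun k (_ : X k) => ratr (nth 0 (rcons s q) k)) x.1 =
   sumZ (fun k (_ : X k) => ratr (nth 0 s k) : R) x.1.
  rewrite -!sumZE; apply: eq_bigr => k _.
  by rewrite nth_rcons ss ltn_ord.
lra.
Qed.

End box_base.

(** * Optimal plans are exactly the couplings with null slack *)

Section slackness.
Context {R : realType} (n : nat) (X : nat -> completePseudoMetricType R).
Local Notation Z := (Zt X n.+1).
Hypothesis rX : forall k, (k <= n.+1)%N -> radon_space R (X k).
Variable mu : forall k : nat, probability (borelT (X k)) R.
Variable c : Z -> R.
Hypothesis c_lsc : lower_semicontinuous (fun x : Z => (c x)%:E).
Variable phi : forall k : nat, X k -> R.
Hypothesis phi_sol : dual_solution mu c phi.

Definition slack (x : Z) : R := c x - sumZ phi x.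

Let L1phi : all_L1 n.+1 mu phi.
Proof. by case: phi_sol => -[]. Qed.

Lemma slack_ge0 x : 0 <= slack x.
Proof. by case: phi_sol => -[_ + _] => /(_ x); rewrite sumZE subr_ge0. Qed.

Lemma dual_valueE psi : all_L1 n.+1 mu psi ->
  @dual_value R X n mu psi = (marginal_sum n.+1 mu psi)%:E.
Proof.
move=> Lpsi; rewrite /dual_value /marginal_sum -sumEFin; apply: eq_bigr => k _.
have kn : (k <= n.+1)%N by rewrite -ltnS.
rewrite /Rintegral fineK//; apply: integrable_fin_num => //; exact: (Lpsi k kn).
Qed.

(* [phi - psi / (s + 1)] is feasible, so optimality of [phi] bounds the value of [psi]. *)
Lemma slack_dual psi s : all_L1 n.+1 mu psi -> 0 <= s ->
  (forall x, 0 <= sumZ psi x + s * slack x) -> 0 <= marginal_sum n.+1 mu psi.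
Proof.
move=> Lpsi s0 hs.
(* Dividing by [s + 1] covers [s = 0] and makes the factor [s / (s + 1)] of the slack at most 1. *)
have s1 : 0 < s + 1 by lra.
have [L1' J1] := all_L1Z (- (s + 1)^-1) Lpsi.
have [L2 J2] := all_L1D L1phi L1'.
have [_ /(_ (fun k x => @phi k x + - (s + 1)^-1 * psi k x))] := phi_sol.
rewrite !dual_valueE// lee_fin J2 J1 => h.
suff : 0 <= (s + 1)^-1 * marginal_sum n.+1 mu psi by rewrite pmulr_rge0// invr_gt0.
suff : marginal_sum n.+1 mu phi + - (s + 1)^-1 * marginal_sum n.+1 mu psi <=
  marginal_sum n.+1 mu phi by lra.
apply: h; split; first exact: L2.
move=> x.
rewrite (sumZE (fun k x => @phi k x + - (s + 1)^-1 * psi k x)) sumZD sumZZ mulNr.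
have := hs x; rewrite -(pmulr_rge0 _ (x := (s + 1)^-1)) ?invr_gt0// mulrDr mulrA.
have : (s + 1)^-1 * s * slack x <= slack x.
  rewrite ler_piMl ?slack_ge0// mulrC ler_pdivrMr//; lra.
rewrite /slack; lra.
Qed.

(** Near a point of positive slack, [c] is bounded below on an open box and the [phi k] are bounded
    above by rationals; this gives countably many Borel boxes with slack bounded away from 0. They
    are null for the content, hence for [P], which agrees with it on boxes. *)
Lemma slack_null_coupling : exists2 P : probability (borelT Z) R,
  Pi mu P & exists2 N : set Z, borel N /\ [set x | 0 < slack x] `<=` N & P N = 0%E.
Proof.
have [m [mD m1 mcyl mnull]] := dual_content slack_ge0 slack_dual.
have [P [Pcyl Pbox]] := coupling_of_content rX mD m1 mcyl.
exists P.
  move=> k A bA; have H : (k <= n.+1)%N by rewrite -ltnS.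
  rewrite -(Pcyl k H A bA); congr (P _).
  by apply/seteqP; split => x /=; rewrite (coordZE (k := k) x H).
have hU k : exists U : nat -> set (X k), (k <= n.+1)%N -> (forall i, open (U i)) /\
    forall x V, nbhs x V -> exists i, U i x /\ U i `<=` V.
  have [kn|kn] := boolP (k <= n.+1)%N; last by exists (fun=> set0).
  by have [_ [U HU] _] := rX kn; exists U.
pose U k := sval (cid (hU k)).
have oU k : (k <= n.+1)%N -> forall i, open (U k i) by move=> kn; have [] := svalP (cid (hU k)) kn.
have bU k : (k <= n.+1)%N -> forall x V, nbhs x V -> exists i, U k i x /\ U k i `<=` V.
  by move=> kn; have [] := svalP (cid (hU k)) kn.
(* An index holds the code of a basic box, rational upper bounds for the [phi k] and a rational
   lower bound for [c]; [t i] is the resulting lower bound of the slack. *)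
pose K (i : seq nat * seq rat * rat) k := U k (nth 0%N i.1.1 k) `&`
  [set y | @phi k y < ratr (nth 0 i.1.2 k)].
pose t (i : seq nat * seq rat * rat) : R :=
  ratr i.2 - \sum_(k < n.+2) ratr (nth 0 i.1.2 k).
pose good (i : seq nat * seq rat * rat) := 0 < t i /\
  boxZ (fun k => U k (nth 0%N i.1.1 k)) n.+1 `<=` [set x | ratr i.2 < c x].
have bK i k : (k <= n.+1)%N -> borel (K i k).
  move=> kn; apply: borelI; first by apply: borel_open; exact: oU.
  have /measurable_int/measurable_EFinP mphi := L1phi kn.
  have := mphi measurableT _ (measurable_itv `]-oo, (ratr (nth 0 i.1.2 k) : R)[).
  rewrite setTI /preimage /=.
  by under eq_set do rewrite in_itv/=.
have goodP i : good i -> P (boxZ (K i) n.+1) = 0%E.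
  move=> [t0 Kc]; rewrite Pbox; last exact: bK.
  rewrite (mnull _ (t i))// => x Kx.
  have cx : ratr i.2 < c x.
    by apply: Kc; apply/boxZP => k H; move/boxZP: Kx => /(_ k H)[].
  have : sumZ phi x <= \sum_(k < n.+2) ratr (nth 0 i.1.2 k).
    rewrite -sumZE; apply: ler_sum => k _.
    have H : (k <= n.+1)%N by rewrite -ltnS.
    move/boxZP: Kx => /(_ k H)[_ /=]; rewrite (coordZE (k := k) x H); exact: ltW.
  rewrite /t /slack; lra.
pose A (j : nat) := if (unpickle j : option (seq nat * seq rat * rat)) is Some i then
  (if pselect (good i) then boxZ (K i) n.+1 else set0) else set0.
have bA j : borel (A j).
  rewrite /A; case: unpickle => [i|]; last exact: borel0.
  by case: pselect => ?; [exact: (borel_box (leqnn n.+1) (bK i))|exact: borel0].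
have PA j : rpr P (A j) = 0.
  rewrite /A /rpr; case: unpickle => [i|]; last by rewrite measure0.
  by case: pselect => ?; [rewrite goodP|rewrite measure0].
exists (\bigcup_j A j).
  split; first exact: borel_bigcup.
  (* Less than half of the slack is lost on the [phi k] and less than half on [c], so [t] stays
     positive. *)
  move=> x /= sx; pose e := slack x / 2.
  have e0 : 0 < e by rewrite divr_gt0.
  have [q [sq q1 q2]] := sumZ_rat_approx phi x e0.
  have [|q0] := @rat_in_itvoo R (c x - e) (c x) _; first by rewrite ltrBlDr ltrDl.
  rewrite in_itv/= => /andP[q01 q02].
  have [V nV Vc] := c_lsc (x := x) (a := ratr q0) q02.
  have [s [ss sx' sV]] := box_base bU nV.
  have gi : good (s, q, q0).
    split; last by move=> y /sV /Vc.
    rewrite /t /=; move: q2; rewrite -sumZE; move: q01; rewrite /e /slack; lra.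
  exists (pickle (s, q, q0)) => //; rewrite /A pickleK; case: pselect => // ?.
  apply/boxZP => k H; split => /=; last exact: q1.
  by move/boxZP : sx'; exact.
rewrite rprE; last exact: borel_bigcup.
congr EFin; apply/eqP; rewrite eq_le; apply/andP; split; last first.
  by case: (rpr_additive P) => _ [_ + _]; apply; exact: borel_bigcup.
apply/ler_addgt0Pr => e e0; rewrite add0r; apply: rpr_bigcup_le => // i.
by rewrite PA divr_ge0// ltW.
Qed.

Lemma measurable_cost : measurable_fun setT (c : borelT Z -> R).
Proof.
apply/measurable_EFinP; apply: (measurability _ (ErealGenOInfty.measurableE R)).
move=> /= _ [_ [a ->]] <-; rewrite setTI; apply: sub_sigma_algebra.
by rewrite preimage_itvoy; move/lower_semicontinuousP : c_lsc; exact.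
Qed.

Section coupling_integral.
Variable P : probability (borelT Z) R.
Hypothesis PiP : Pi mu P.

Let mcoord (k : 'I_n.+2) : measurable_fun setT (coordZ k : borelT Z -> borelT (X k)).
Proof.
have H : (k <= n.+1)%N by rewrite -ltnS.
rewrite (_ : coordZ k = cz H); last by apply/funext => x; exact: coordZE.
by apply: continuous_borel; exact: continuous_cz.
Qed.

Lemma coupling_integral_coord (k : 'I_n.+2) (f : X k -> R) : L1 mu f ->
  P.-integrable setT (fun x => (f (coordZ k x))%:E) /\
  (\int[P]_x (f (coordZ k x))%:E = \int[mu k]_x (f x)%:E)%E.
Proof.
move=> Lf; have mf := measurable_int _ Lf.
have eqmu (g : borelT (X k) -> \bar R) :
    (\int[pushforward P (coordZ k : borelT Z -> borelT (X k))]_x g x = \int[mu k]_x g x)%E.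
  by apply: eq_measure_integral => A mA _; exact: PiP.
have iP : P.-integrable setT (fun x => (f (coordZ k x))%:E).
  apply/integrableP; split.
    exact: measurableT_comp mf (mcoord (k := k)).
  have := ge0_integral_pushforward (mcoord (k := k)) P (D := setT)
    (f := fun y : borelT (X k) => `|(f y)%:E|%E) measurableT.
  rewrite preimage_setT /comp => <-.
  - by rewrite eqmu; case/integrableP : Lf.
  - exact: measurableT_comp.
  - by move=> y _; exact: abse_ge0.
split => //; rewrite -eqmu.
by rewrite (integral_pushforward (mcoord (k := k)) mf _ measurableT) preimage_setT.
Qed.

Lemma coupling_integral_sumZ : P.-integrable setT (fun x => (sumZ phi x)%:E) /\
  (\int[P]_x (sumZ phi x)%:E = (marginal_sum n.+1 mu phi)%:E)%E.
Proof.
have E : (fun x : Z => (sumZ phi x)%:E) =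
    (fun x => \sum_(k < n.+2) (@phi k (coordZ k x))%:E)%E.
  by apply/funext => x; rewrite -sumZE sumEFin.
have Lk (k : 'I_n.+2) : L1 mu (@phi k) by apply: L1phi; rewrite -ltnS.
rewrite E; split.
  by apply: integrable_sum => //= k _; have [] := coupling_integral_coord (Lk k).
rewrite integral_sum//; last by move=> k; have [] := coupling_integral_coord (Lk k).
rewrite -(dual_valueE L1phi); apply: eq_bigr => k _.
by have [] := coupling_integral_coord (Lk k).
Qed.

(** The integral of the slack is the cost minus the dual value, hence at most 0, while the slack is
    nonnegative. *)
Lemma slack_null_of_cost_le : (cost c P <= (marginal_sum n.+1 mu phi)%:E)%E ->
  borel [set x | slack x = 0] /\ P (~` [set x | slack x = 0]) = 0%E.
Proof.
move=> cP; have [iphi Iphi] := coupling_integral_sumZ.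
have mc := measurable_cost.
have mphi : measurable_fun setT (@sumZ R X phi n.+1 : borelT Z -> R).
  by apply/measurable_EFinP; exact: measurable_int iphi.
have ms : measurable_fun setT (slack : borelT Z -> R) by exact: measurable_funB.
have ms' : measurable_fun setT (EFin \o slack : borelT Z -> \bar R) by exact/measurable_EFinP.
have mc' : measurable_fun setT (EFin \o c : borelT Z -> \bar R) by exact/measurable_EFinP.
pose f : borelT Z -> \bar R := fun x => (sumZ phi x)%:E.
pose g : borelT Z -> \bar R := fun x => (c x)%:E.
have mf : measurable_fun setT f by exact: measurable_int iphi.
have fp : (\int[P]_x f^\+ x)%E \is a fin_num by apply: integrable_pos_fin_num.
have fn : (\int[P]_x f^\- x)%E \is a fin_num by apply: integrable_neg_fin_num.
(* [c] lies above the integrable [sumZ phi], so its negative part has a finite integral. *)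
have gn : (\int[P]_x g^\- x)%E \is a fin_num.
  rewrite ge0_fin_numE; last by apply: integral_ge0 => x _; exact: funeneg_ge0.
  move: fn; rewrite ge0_fin_numE; last by apply: integral_ge0 => x _; exact: funeneg_ge0.
  apply: le_lt_trans; apply: ge0_le_integral => //.
  - exact: measurable_funeneg.
  - exact: measurable_funeneg.
  - move=> x _; rewrite !funenegE /f /g -!EFinN -!EFin_max lee_fin.
    have := slack_ge0 x; rewrite /slack.
    by case: (lerP (- c x) 0); case: (lerP (- sumZ phi x) 0); lra.
(* This is [c = sumZ phi + slack] rearranged into sums of nonnegative terms, since the positive part
   of [c] is not known to be integrable. *)
have key : (\int[P]_x (g^\+ x) + \int[P]_x (f^\- x) =
    \int[P]_x (f^\+ x) + \int[P]_x (slack x)%:E + \int[P]_x (g^\- x))%E.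
  have mgp : measurable_fun setT (g^\+)%E by exact: measurable_funepos.
  have mgn : measurable_fun setT (g^\-)%E by exact: measurable_funeneg.
  have mfp : measurable_fun setT (f^\+)%E by exact: measurable_funepos.
  have mfn : measurable_fun setT (f^\-)%E by exact: measurable_funeneg.
  have sl0 (x : borelT Z) : setT x -> (0 <= (slack x)%:E)%E.
    by rewrite lee_fin slack_ge0.
  have fsl0 (x : borelT Z) : setT x -> (0 <= f^\+ x + (slack x)%:E)%E.
    by move=> _; rewrite adde_ge0 ?funepos_ge0// sl0.
  have mfs : measurable_fun setT (fun x => f^\+ x + (slack x)%:E)%E.
    exact: emeasurable_funD.
  rewrite -(ge0_integralD P measurableT _ mgp _ mfn)//.
  rewrite -(ge0_integralD P measurableT _ mfp sl0 ms')//.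
  rewrite -(ge0_integralD P measurableT fsl0 mfs _ mgn)//.
  apply: eq_integral => x _; rewrite !funenegE !funeposE /f /g -!EFinN -!EFin_max -!EFinD.
  congr EFin; rewrite /slack.
  by case: (lerP (- c x) 0); case: (lerP (- sumZ phi x) 0); case: (lerP (c x) 0);
    case: (lerP (sumZ phi x) 0); lra.
have s0 : (\int[P]_x (slack x)%:E <= 0)%E.
  move: cP; rewrite -Iphi /cost integralE -/g [leRHS]integralE -/f.
  move: key fp fn gn; set gp := (\int[P]_x g^\+ x)%E; set ir := (\int[P]_x (slack x)%:E)%E.
  move: (\int[P]_x f^\+ x)%E (\int[P]_x f^\- x)%E (\int[P]_x g^\- x)%E.
  move=> [a| |] [b| |] [d| |] // + _ _ _.
  have ir0 : (0 <= ir)%E by apply: integral_ge0 => x _; rewrite lee_fin slack_ge0.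
  move: gp ir ir0 => [p| |] [i| |] //= _; rewrite -?EFinD ?lee_fin => -[]; lra.
have : ae_eq P setT (EFin \o slack : borelT Z -> \bar R) (cst 0%E).
  apply/ae_eq_integral_abs => //; apply/eqP; rewrite eq_le; apply/andP; split.
    apply: le_trans s0; apply: ge0_le_integral => //.
    - exact: measurableT_comp.
    - by move=> x _; rewrite /= lee_fin ger0_norm ?slack_ge0.
  by apply: integral_ge0 => x _; exact: abse_ge0.
have b0 : borel [set x | slack x = 0].
  have := ms measurableT _ (measurable_set1 (0 : R)).
  by rewrite setTI.
move=> [N [mN N0 sN]]; split => //.
apply/eqP; rewrite eq_le measure_ge0 andbT -N0; apply: le_measure.
- by rewrite inE; exact: borelC.
- by rewrite inE.
- by move=> x sx; apply: sN => /= h; apply: sx; have := h Logic.I; move=> [].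
Qed.

End coupling_integral.

Lemma cost_slack_null (P : probability (borelT Z) R) (N : set Z) : Pi mu P ->
  borel N -> [set x | 0 < slack x] `<=` N -> P N = 0%E ->
  cost c P = (marginal_sum n.+1 mu phi)%:E.
Proof.
move=> PiP bN sN PN; have [iP <-] := coupling_integral_sumZ PiP.
rewrite /cost; apply: ae_eq_integral => //.
- by apply/measurable_EFinP; exact: measurable_cost.
- exact: measurable_int iP.
exists N; split => // x /= h; apply: sN => /=; rewrite lt0r slack_ge0 andbT.
apply/eqP => s0; apply: h => _; congr EFin; apply/eqP.
by rewrite -subr_eq0; apply/eqP.
Qed.

(** The coupling built from the dual content costs exactly the dual value, so an optimal plan costs
    no more. *)
Lemma optimal_slack_null P : optimal_plan mu c P ->
  borel [set x | slack x = 0] /\ P (~` [set x | slack x = 0]) = 0%E.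
Proof.
move=> [PiP optP]; apply: slack_null_of_cost_le => //.
have [Q PiQ [N [bN sN] QN]] := slack_null_coupling.
by rewrite -(cost_slack_null PiQ bN sN QN); exact: optP.
Qed.

(** Null slack makes the cost equal to the dual value, which is the optimal cost. This serves to
    show that the average of two optimal plans is optimal. *)
Lemma slack_null_optimal P P' : optimal_plan mu c P -> Pi mu P' ->
  P' (~` [set x | slack x = 0]) = 0%E -> optimal_plan mu c P'.
Proof.
move=> optP PiP' P'0; have [bs P0] := optimal_slack_null optP.
have sN : [set x | 0 < slack x] `<=` ~` [set x | slack x = 0].
  by move=> x /= sx s0; rewrite s0 ltxx in sx.
split => // Q PiQ; have [PiP /(_ _ PiQ)] := optP.
by rewrite (cost_slack_null PiP (borelC bs) sN P0) (cost_slack_null PiP' (borelC bs) sN P'0).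
Qed.

End slackness.

(** * Extreme plans and the induction on the number of factors *)

Lemma average_probability (R : realType) (T : ptopologicalType)
    (P1 P2 : probability (borelT T) R) : exists Q : probability (borelT T) R,
  forall E, (Q E = 2^-1%:E * (P1 E + P2 E))%E.
Proof.
have h0 : 0 <= 2^-1 :> R by rewrite invr_ge0.
pose m : {measure set (borelT T) -> \bar R} := mscale (NngNum h0) (measure_add P1 P2).
have mE E : (m E = 2^-1%:E * (P1 E + P2 E))%E by rewrite -measure_addE.
have [|Q QE] := probability_of_measure (m := m).
  by rewrite mE !probability_setT -EFinD -EFinM mulVf// pnatr_eq0.
by exists Q => E; rewrite QE mE.
Qed.

Section average_null.
Context {R : realType} {T : ptopologicalType}.
Variables P1 P2 Q : probability (borelT T) R.
Hypothesis QE : forall E, (Q E = 2^-1%:E * (P1 E + P2 E))%E.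

Lemma average_null E : borel E -> Q E = 0%E -> P1 E = 0%E /\ P2 E = 0%E.
Proof.
move=> bE; rewrite QE !rprE// -EFinD -EFinM => -[h].
case: (rpr_additive P1) => _ [_ /(_ E bE) h1 _].
by case: (rpr_additive P2) => _ [_ /(_ E bE) h2 _]; split; congr EFin; lra.
Qed.

End average_null.

Lemma closed_Spt (T : topologicalType) (R : realType) (rho : set T -> \bar R) :
  closed (Spt rho).
Proof.
move=> x cx U oU Ux; have [y [Sy Uy]] := cx U (open_nbhs_nbhs (conj oU Ux)).
exact: Sy.
Qed.

(** The complement of the support is a union of null base sets, of which there are countably
    many. *)
Lemma Spt_full (R : realType) (T : ptopologicalType) (P : probability (borelT T) R) :
  has_base T -> P (~` Spt P) = 0%E.
Proof.
move=> [W_ [oW bW]].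
pose A i := if pselect (rpr P (W_ i) = 0) then W_ i else set0.
have bA i : borel (A i).
  by rewrite /A; case: pselect => ?; [apply: borel_open; exact: oW|exact: borel0].
have -> : ~` Spt P = \bigcup_i A i.
  apply/seteqP; split => x.
    move=> /existsNP[U /not_implyP[oU /not_implyP[Ux PU]]].
    have [i [Wx WU]] := bW x U (open_nbhs_nbhs (conj oU Ux)).
    exists i => //; rewrite /A; case: pselect => //; case.
    have bWi := borel_open (oW i); have bU := borel_open oU.
    apply/eqP; rewrite eq_le; apply/andP; split; last first.
      by case: (rpr_additive P) => _ [_ + _]; apply.
    apply: le_trans (additive_on_le (rpr_additive P) bWi bU WU) _.
    by rewrite leNgt -lte_fin -rprE//; apply/negP.
  move=> [i _]; rewrite /A; case: pselect => // P0 Wx Sx.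
  by have := Sx _ (oW i) Wx; rewrite rprE ?P0 ?ltxx//; exact: borel_open.
rewrite rprE; last exact: borel_bigcup.
congr EFin; apply/eqP; rewrite eq_le; apply/andP; split; last first.
  by case: (rpr_additive P) => _ [_ + _]; apply; exact: borel_bigcup.
apply/ler_addgt0Pr => e e0; rewrite add0r; apply: rpr_bigcup_le => // i.
rewrite /A; case: pselect => [->|?]; last rewrite /rpr measure0.
  by rewrite divr_ge0// ltW.
by rewrite divr_ge0// ltW.
Qed.

(** * The lexicographic order on a factor *)

Section lexicographic.
Context {R : realType} {B : ptopologicalType}.
Variables (I : set nat) (Y : nat -> set B) (f : B -> R).
Hypothesis bY : forall i, I i -> borel (Y i).
Hypothesis mf : measurable_fun setT (f : borelT B -> R).

(* The sets [lex_segment i q] are upper sets for the order on [B] that prefers small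
   block indices and, within a block, large values of [f]. *)
Definition lex_segment (i : nat) (q : rat) : set B :=
  [set b | (exists l, [/\ (l < i)%N, I l & Y l b]) \/ [/\ I i, Y i b & ratr q < f b]].

Definition lex_segment_nat (t : nat) : set B :=
  if (unpickle t : option (nat * rat)) is Some iq then lex_segment iq.1 iq.2 else set0.

Lemma borel_lex_segment t : borel (lex_segment_nat t).
Proof.
rewrite /lex_segment_nat; case: unpickle => [[i q]|] /=; last exact: borel0.
pose F l := if pselect (I l) then Y l else set0.
have bF l : borel (F l) by rewrite /F; case: pselect => ?; [exact: bY|exact: borel0].
have -> : lex_segment i q = \big[setU/set0]_(l < i) F l `|` (F i `&` [set b | ratr q < f b]).
  apply/seteqP; split => b.
    move=> [[l [li Il Yl]]|[Ii Yi qf]].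
      left; rewrite -(bigcup_mkord i F); exists l => //.
      by rewrite /F; case: pselect.
    by right; split => //; rewrite /F; case: pselect.
  case; first rewrite -(bigcup_mkord i F).
    by move=> [l /= li]; rewrite /F; case: pselect => // Il Yl; left; exists l.
  by move=> [+ qf]; rewrite /F; case: pselect => // Ii Yi; right.
apply: borelU; first exact: borel_bigsetU.
apply: borelI => //.
have := mf measurableT (measurable_itv `](ratr q : R), +oo[).
rewrite setTI /preimage /=.
by under eq_set do rewrite in_itv/= andbT.
Qed.

Lemma lex_segment_chain s t : lex_segment_nat s `<=` lex_segment_nat t \/
  lex_segment_nat t `<=` lex_segment_nat s.
Proof.
rewrite /lex_segment_nat; case: (unpickle s) => [[i q]|]; last by left.
case: (unpickle t) => [[j p]|]; last by right.
have lt i' j' q' p' : (i' < j')%N -> lex_segment i' q' `<=` lex_segment j' p'.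
  move=> ij b [[l [li Il Yl]]|[Ii Yi _]]; left.
    by exists l; split => //; exact: ltn_trans ij.
  by exists i'.
rewrite /=; case: (ltngtP i j) => [ij|ji|<-]; [left; exact: lt|right; exact: lt|].
have le p' q' : p' <= q' -> lex_segment i q' `<=` lex_segment i p'.
  move=> pq b [|[Ii Yi qf]]; [by left|right; split => //].
  by apply: le_lt_trans qf; rewrite ler_rat.
by case: (lerP p q) => pq; [left; exact: le|right; apply: le; exact: ltW].
Qed.

(** Rational thresholds separate values: a rational between [f b'] and [f b] would give a segment
    containing [b] but not [b']. *)
Lemma lex_segment_le b b' i : I i -> Y i b ->
  (forall t, lex_segment_nat t b -> lex_segment_nat t b') ->
  (forall l, I l -> Y l b' -> (i <= l)%N) -> Y i b' /\ f b <= f b'.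
Proof.
move=> Ii Yib h hl.
have h' j q : lex_segment j q b -> lex_segment j q b'.
  by have := h (pickle (j, q)); rewrite /lex_segment_nat pickleK.
split.
  (* The segment of index [i.+1] contains [b] through block [i]; with a threshold above [f b'], it
     can contain [b'] only through a block of index at most [i]. *)
  have [|q] := @rat_in_itvoo R (f b') (f b' + 1) _; first by rewrite ltrDl.
  rewrite in_itv/= => /andP[q1 _].
  have [|[l [li Il Yl]]|[_ _ q2]] := h' i.+1 q.
  - by left; exists i.
  - suff : l = i by move=> <-.
    by apply/eqP; rewrite eqn_leq hl// andbT -ltnS.
  - by have := lt_trans q1 q2; rewrite ltxx.
rewrite leNgt; apply/negP => /rat_in_itvoo[q].
rewrite in_itv/= => /andP[q1 q2].
have [|[l [li Il Yl]]|[_ _ q3]] := h' i q.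
- by right.
- by have := hl _ Il Yl; rewrite leqNgt li.
- by have := lt_trans q1 q3; rewrite ltxx.
Qed.

End lexicographic.

(** * Uniqueness from extremality on a product of two factors *)

Section extreme_unique.
Context {R : realType} {A B : ptopologicalType}.
Hypothesis rAB : radon_space R (A * B)%type.
Hypotheses (hA : hausdorff_space A) (hB : hausdorff_space B).
Variables P1 P2 Q : probability (borelT (A * B)%type) R.
Hypothesis QE : forall E, (Q E = 2^-1%:E * (P1 E + P2 E))%E.
Hypothesis eqA : forall E, borel E -> P1 (fst @^-1` E) = P2 (fst @^-1` E).
Hypothesis eqB : forall E, borel E -> P1 (snd @^-1` E) = P2 (snd @^-1` E).
Variables (g : A -> B -> R) (I : set nat) (Y : nat -> set B).
Hypothesis bY : forall i, I i -> borel (Y i).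
Hypothesis ext : extreme g Q I Y.
Variables (F : A -> R) (f : B -> R) (C : set (A * B)).
Hypothesis mf : measurable_fun setT (f : borelT B -> R).
Hypotheses (bC : borel C) (QC : Q (~` C) = 0%E).
Hypothesis gC : forall a b, C (a, b) -> g a b = F a + f b.

(** By extremality the dominated points of [S] form an antigraph: each can be avoided by the
    selection in its fiber, so two of them in distinct fibers cannot share their second coordinate.
    Then [two_limbs] applies with the lexicographic order. *)
Lemma extreme_unique E : borel E -> P1 E = P2 E.
Proof.
have [A0 [B0 [[bA0 bB0] QA0 QB0 dom dis]]] := ext.
have cf : continuous (fst : A * B -> A) by move=> x; exact: cvg_fst.
have cs : continuous (snd : A * B -> B) by move=> x; exact: cvg_snd.
have bfA : borel (fst @^-1` A0 : set (A * B)) by exact: continuous_preimage_borel.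
have bsB : borel (snd @^-1` B0 : set (A * B)) by exact: continuous_preimage_borel.
have EA : A0 `*` [set: B] = fst @^-1` A0.
  by apply/seteqP; split => x; [case|split].
have EB : [set: A] `*` B0 = snd @^-1` B0.
  by apply/seteqP; split => x; [case|split].
have [_ base _] := rAB.
pose S := Spt Q `&` fst @^-1` A0 `&` snd @^-1` B0 `&` C.
have bSpt : borel (Spt Q) by apply: borel_closed; exact: closed_Spt.
have bS : borel S by do ?[apply: borelI].
have nA : Q (~` (fst @^-1` A0)) = 0%E.
  by rewrite probability_setC// -EA QA0 subee.
have nB : Q (~` (snd @^-1` B0)) = 0%E.
  by rewrite probability_setC// -EB QB0 subee.
have nS : Q (~` S) = 0%E.
  have bAB := borelI bfA bsB.
  rewrite /S -!setIA !setCI measureU0//; last 2 first.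
  - by rewrite -!setCI; apply: borelC; apply: borelI => //; exact: borelI.
  - rewrite measureU0//; [exact: borelC| |]; first by apply: borelU; exact: borelC.
    by rewrite measureU0//; exact: borelC.
  - exact: Spt_full.
  - exact: borelC.
have [n1 n2] := average_null QE (borelC bS) nS.
(* Either the given maximizer differs from the dominated point, or the dominating point, being in
   the same block with [g] at least as large, is another maximizer. *)
have better x : dominated fst (fun t => snd @^-1` lex_segment_nat I Y f t) S x ->
    exists2 b', f_ g Q I Y x.1 b' & b' <> x.2.
  case: x => a b [[[[Sab Aa] Bb] Cab] [[a' b'] [[[[Sab' _] _] Cab'] /= aa' neq h]]].
  subst a'; have bb' : b' <> b by move=> bb'; apply: neq; rewrite bb'.
  have [e fe] : Domf g Q I Y a.
    have : (DomF Q `&` A0) a by split => //; exists b.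
    by rewrite dom => -[].
  have [eb|eb] := pselect (e = b); last by exists e.
  subst e; exists b' => //; case: fe => i [[Ii Fi mini] Fb Yb maxb].
  have [Yb' fbb'] : Y i b' /\ f b <= f b'.
    apply: (lex_segment_le (I := I) (Y := Y)) => // l Il Yl; apply: mini => //.
    by exists b'.
  exists i; split => // b'' Fb'' Yb''; apply: le_trans (maxb b'' Fb'' Yb'') _.
  by rewrite !gC// lerD2l.
move=> bE; refine (two_limbs rAB hA hB cf cs eqA eqB bS _ _
  (V := lex_segment_nat I Y f) _ _ _ bE).
- by rewrite /rpr n1.
- by rewrite /rpr n2.
- exact: borel_lex_segment.
- exact: lex_segment_chain.
move=> x y; rewrite !inE => dx dy xy.
have [b1 f1 n1'] := better _ dx; have [b2 f2 n2'] := better _ dy.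
have [[[[Sx Ax] Bx] _] _] := dx; have [[[[Sy Ay] By] _] _] := dy.
have [e|ne] := pselect (x.1 = y.1).
  by case: x y e xy {dx dy f1 f2 n1' n2' Sx Ax Bx Sy Ay By} => [? ?] [? ?] /= -> ->.
(* The common second coordinate lies in the intersection that condition (ii) declares empty, the two
   selections having been chosen away from it. *)
exfalso; have := dis _ _ Ax Ay ne _ _ f1 f2.
apply/eqP/set0P; exists x.2; split => //; split.
  by split; [case: (x) Sx|move=> e; exact: n1'].
by rewrite xy; split; [case: (y) Sy|move=> e; exact: n2'].
Qed.

End extreme_unique.

Lemma radon_polish_family (R : realType) (X : nat -> completePseudoMetricType R) n :
  polish_family X n -> forall k, (k <= n.+1)%N -> radon_space R (X k).
Proof.
move=> hX k kn; have [hk [D [cD dD]]] := hX k kn.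
by have [d hd] := dense_sequence cD dD; exact: radon_polish hd.
Qed.

(** * Reduced costs at tight points, and the induction over the factors *)

Section cost_on_slack_null.
Context {R : realType} (n : nat) (X : nat -> completePseudoMetricType R).
Variables (mu : forall k : nat, probability (borelT (X k)) R) (c : Zt X n.+1 -> R).
Variable phi : forall k : nat, X k -> R.
Hypothesis phi_sol : dual_solution mu c phi.

(* The infimum defining [c_j] is attained above the projection of a point where the
   dual constraint is tight. *)
Lemma cj_slack_null m (Hm : (m <= n.+1)%N) (x : Zt X n.+1) :
  slack c phi x = 0 -> cj c phi Hm (restr Hm x) = sumZ phi (restr Hm x).
Proof.
move=> sx; rewrite /cj.
set S := [set _ | _ in _].
have lbS : lbound S (sumZ phi (restr Hm x)).
  move=> _ [y /= yx <-]; rewrite sumZ_restr yx.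
  by have := slack_ge0 phi_sol y; rewrite /slack; lra.
have Sx : S (sumZ phi (restr Hm x)).
  by exists x => //; rewrite sumZ_restr; move: sx; rewrite /slack; lra.
apply/eqP; rewrite eq_le; apply/andP; split.
  by apply: ge_inf => //; exists (sumZ phi (restr Hm x)).
by apply: lb_le_inf => //; exists (sumZ phi (restr Hm x)).
Qed.

End cost_on_slack_null.

(* N = n.+2 >= 3 spaces X 0, ..., X n.+1 (0-based; paper's X_k is X (k-1)). *)
Theorem mainTheorem4 (R : realType) (n : nat) (hn : (1 <= n)%N)
  (X : nat -> completePseudoMetricType R)
  (hX : polish_family X n)
  (mu : forall k : nat, probability (borelT (X k)) R)
  (c : Zt X n.+1 -> R)
  (hc_lsc : lower_semicontinuous (fun x : Zt X n.+1 => (c x)%:E))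
  (a : forall k : nat, X k -> R)
  (ha : forall k, (k <= n.+1)%N -> L1 mu (a k))
  (hca : forall x : Zt X n.+1, \sum_(k < n.+2) a k (coordZ k x) <= c x)
  (hattained : exists lam, optimal_plan mu c lam)
  (phi : forall k : nat, X k -> R)
  (hphi : dual_solution mu c phi)
  (L : nat -> nat) (Y : forall k : nat, nat -> set (X k))
  (hY : forall k, (1 <= k <= n.+1)%N ->
          ordered_borel_partition [set l | (l < L k)%N] (Y k))
  (hextN : forall lam, optimal_plan mu c lam ->
     @extreme R (Zt X n) (X n.+1) (fun a b => c (a, b))
       (fun S => lam S) [set l | (l < L n.+1)%N] (Y n.+1))
  (hextj : forall lam, optimal_plan mu c lam ->
     forall m (Hm : (m.+1 <= n)%N),
     @extreme R (Zt X m) (X m.+1) (fun a b => cj c phi (leqW Hm) (a, b))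
       (proj_plan lam (leqW Hm)) [set l | (l < L m.+1)%N] (Y m.+1)) :
  exists lam, optimal_plan mu c lam /\
    forall lam1 lam2, optimal_plan mu c lam1 -> optimal_plan mu c lam2 ->
      forall S : set (Zt X n.+1), borel S -> lam1 S = lam2 S.
Proof.
have rX := radon_polish_family hX.
have [lam optlam] := hattained.
exists lam; split => // P1 P2 opt1 opt2.
(* Extremality is used for the average, whose null sets are null for both plans, so that its support
   carries both. *)
have [Q QE] := average_probability P1 P2.
have PiP1 := opt1.1; have PiP2 := opt2.1.
have [bN P1N] := optimal_slack_null rX hc_lsc hphi opt1.
have [_ P2N] := optimal_slack_null rX hc_lsc hphi opt2.
have QN : Q (~` [set x | slack c phi x = 0]) = 0%E by rewrite QE P1N P2N adde0 mule0.
have optQ : optimal_plan mu c Q.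
  apply: (slack_null_optimal rX hc_lsc hphi optlam _ QN) => k A bA.
  rewrite QE PiP1// PiP2// rprE// -EFinD -EFinM; congr EFin; lra.
(* The zero set of the slack is replaced by compacts of full measure: its own projections need not
   be Borel. *)
have [K [cK KN QK _]] := lusin_sigma_compact (radon_Zt rX) Q bN (fun=> bN).
have hZ m (Hm : (m <= n.+1)%N) : radon_space R (Zt X m).
  by apply: radon_Zt => k km; apply: rX; exact: leq_trans Hm.
have bK : borel (\bigcup_i K i).
  by apply: borel_bigcup => i; apply: borel_compact => //; case: (hZ n.+1 (leqnn _)).
have QKC : Q (~` \bigcup_i K i) = 0%E.
  rewrite (_ : ~` (\bigcup_i K i) = ~` [set x | slack c phi x = 0] `|`
      ([set x | slack c phi x = 0] `\` \bigcup_i K i)).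
    have bD := borelD bN bK.
    have QD : Q ([set x | slack c phi x = 0] `\` \bigcup_i K i) = 0%E.
      by rewrite (rprE Q bD) QK.
    by rewrite measureU0//; exact: borelC.
  apply/seteqP; split => x.
    by move=> Kx; have [sx|sx] := pselect (slack c phi x = 0); [right|left].
  by move=> [sx [i _ Kx]|[]//]; apply: sx; exact: KN Kx.
suff main m (Hm : (m <= n.+1)%N) E : borel E -> P1 (restr Hm @^-1` E) = P2 (restr Hm @^-1` E).
  move=> S bS; have := main n.+1 (leqnn _) S bS.
  by rewrite (_ : restr (leqnn n.+1) = id)//; apply/funext => x; exact: restr_id.
(* The base case is the common first marginal; each step adds the factor [X m.+1], whose marginal is
   also common. *)
elim: m => [|m IH] in Hm E *.
  move=> bE; have := PiP1 ord0 E bE; rewrite -(PiP2 ord0 E bE).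
  rewrite (_ : coordZ ord0 = restr Hm)//.
  by apply/funext => x; rewrite (coordZE (k := ord0) x Hm).
have Hm' : (m <= n.+1)%N by exact: ltnW.
have [Q1 Q1E] := push_probability P1 (continuous_restr (X := X) (H := Hm)).
have [Q2 Q2E] := push_probability P2 (continuous_restr (X := X) (H := Hm)).
have [Q' Q'E] := push_probability Q (continuous_restr (X := X) (H := Hm)).
have Q'Q E' : (Q' E' = 2^-1%:E * (Q1 E' + Q2 E'))%E by rewrite Q'E Q1E Q2E QE.
move=> bE; rewrite -Q1E -Q2E.
have rfst (x : Zt X n.+1) : (restr Hm x).1 = restr Hm' x.
  by rewrite -(restr_trans (leqnSn m) Hm Hm') (restrS _ (leqnn m)) restr_id.
have rsnd (x : Zt X n.+1) : (restr Hm x).2 = coordZ (Ordinal (Hm : (m.+1 < n.+2)%N)) x.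
  by rewrite (coordZE (k := Ordinal (Hm : (m.+1 < n.+2)%N)) x Hm).
have eqA E' : borel E' -> Q1 (fst @^-1` E') = Q2 (fst @^-1` E').
  move=> bE'; have := IH Hm' E' bE'; rewrite Q1E Q2E.
  by rewrite (_ : restr Hm' = fst \o restr Hm)//; apply/funext => x; rewrite -rfst.
have eqB E' : borel E' -> Q1 (snd @^-1` E') = Q2 (snd @^-1` E').
  move=> bE'; rewrite Q1E Q2E.
  have := PiP1 (Ordinal (Hm : (m.+1 < n.+2)%N)) E' bE'.
  rewrite -(PiP2 (Ordinal (Hm : (m.+1 < n.+2)%N)) E' bE').
  have -> : (coordZ (Ordinal (Hm : (m.+1 < n.+2)%N)) : Zt X n.+1 -> X m.+1) =
    (fun x => (restr Hm x).2) by apply/funext => x; rewrite rsnd.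
  by [].
(* Projections of tight points, where the reduced cost is a function of the first coordinates plus
   [phi m.+1]. *)
pose C := \bigcup_i restr Hm @` (K i).
have hZm : hausdorff_space (Zt X m.+1) by case: (hZ m.+1 Hm).
have bC : borel C.
  apply: borel_bigcup => i; apply: borel_compact => //.
  by apply: continuous_compact => //; apply: continuous_subspaceT; exact: continuous_restr.
have QC : Q' (~` C) = 0%E.
  rewrite Q'E; apply/eqP; rewrite eq_le measure_ge0 andbT -QKC; apply: le_measure.
  - rewrite inE; apply: continuous_preimage_borel; first exact: continuous_restr.
    exact: borelC.
  - by rewrite inE; exact: borelC.
  - by move=> x /= Cx [i _ Kx]; apply: Cx; exists i => //; exists x.
have hX1 : hausdorff_space (X m.+1) by case: (rX m.+1 Hm).
have hZ0 : hausdorff_space (Zt X m) by case: (hZ m Hm').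
have bY i : [set l | (l < L m.+1)%N] i -> borel (Y m.+1 i).
  by have [+ _ _ _] := hY m.+1 Hm; apply.
have mphi : measurable_fun setT (phi m.+1 : borelT (X m.+1) -> R).
  have [[L1phi _] _] := hphi.
  by apply/measurable_EFinP; exact: measurable_int (L1phi m.+1 Hm).
have Cslack z : C z -> exists2 x, slack c phi x = 0 & restr Hm x = z.
  by move=> [i _ [x Kx <-]]; exists x => //; exact: KN Kx.
(* Intermediate factors use extremality for the reduced cost [cj]; the last factor uses it for [c]
   itself. *)
have [mn|mn] := leqP m.+1 n.
  apply: (extreme_unique (hZ m.+1 Hm) hZ0 hX1 Q'Q eqA eqB
    (g := fun a b => cj c phi (leqW mn) (a, b)) (F := sumZ phi (n := m)) bY _ mphi bC QC _ bE).
    have := hextj Q optQ m mn.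
    rewrite (_ : proj_plan Q (leqW mn) = Q')//.
    by apply/funext => E'; rewrite Q'E /proj_plan (eq_irrelevance Hm (leqW mn)).
  move=> a' b' /Cslack[x sx xab].
  have := cj_slack_null hphi (leqW mn) sx.
  by rewrite (eq_irrelevance (leqW mn) Hm) xab.
have mE : m = n by apply/eqP; rewrite eqn_leq -ltnS Hm -ltnS mn.
subst m.
have rid : (restr Hm : Zt X n.+1 -> Zt X n.+1) = id by apply/funext => x; exact: restr_id.
apply: (extreme_unique (hZ n.+1 Hm) hZ0 hX1 Q'Q eqA eqB (g := fun a b => c (a, b))
  (F := sumZ phi (n := n)) bY _ mphi bC QC _ bE).
  have := hextN Q optQ.
  by rewrite (_ : (fun S => Q S) = Q')//; apply/funext => E'; rewrite Q'E rid.
move=> a' b' /Cslack[x sx]; rewrite rid /= => xab.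
by move: sx; rewrite xab /slack => /eqP; rewrite subr_eq0 => /eqP.
Qed.
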